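(* Let $A\in\mathbb{R}^{n\times n}$ be symmetric, $N=n(n-1)/2$, and let $A_k=(\hat a^{(k)}_{ij})$ be the matrix $A_0=A$ after $k$ Jacobi updates generated by the cyclic Jacobi method in floating point arithmetic, where the index pairs $\{(p_k,q_k)\}$ are chosen in a general cyclic order. Let $\varphi_k=((6+4\sqrt2)\|G_k\|_F^2+2\|H_k\|_F^2)^{1/2}$ for all $k\ge0$. Suppose $A_0$ has $n$ distinct eigenvalues and $\|\mathrm{off}(A_0)\|_F<d(A_0)/4$. Suppose $\tilde\gamma_4$ satisfies $$\tfrac18\varphi_k^2\tilde\gamma_4^2+\tfrac12\|\mathrm{off}(A_k)\|_F\,\varphi_k\tilde\gamma_4+\|H_k\|_F^2\tilde\gamma_4+\|G_k\|_F^2\tilde\gamma_4^2<|\hat a^{(k)}_{p_kq_k}|^2\quad\text{for }k=0,1,\dots,N-1,$$ and $$d(A_0)\ge\underline d+\sum_{k=0}^{N-1}2\varphi_k\tilde\gamma_4\quad\text{for some }\underline d>0.$$ Then $$\|\mathrm{off}(A_N)\|_F\le\alpha_1\|\mathrm{off}(A_0)\|_F^2+\beta_1\tilde\gamma_4,$$ where $$\alpha_1=(1+\tilde\gamma_2)^{2n-4}\sqrt{2N}\,\frac{\max_{0\le k\le N-1}\|H_k\|_F}{\min_{0\le k\le N-1}d(A_k)\,\|\mathrm{off}(A_0)\|_F},$$ $$\beta_1=\alpha_1\Big(\sum_{k=0}^{N-1}\|H_k\|_F^2+\sum_{k=0}^{N-1}\|G_k\|_F^2\tilde\gamma_4\B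ig)+(1+\tilde\gamma_2)^{2n-4}\Big(2\sum_{k=0}^{N-1}\|G_k\|_F^2\Big)^{1/2}.$$
   Context: $\|\cdot\|_F$ is the Frobenius norm; $\mathrm{off}(G)=G-\mathrm{diag}(g_{11},\dots,g_{nn})$; eigenvalues of a symmetric matrix $G$ are $\lambda_1(G)\ge\dots\ge\lambda_n(G)$, and $d(G):=\min_{i\ne j}|\lambda_i(G)-\lambda_j(G)|$. General cyclic order: in each sweep of $N$ consecutive steps, starting with $k=0$, every pair $(i,j)$, $1\le i<j\le n$, is chosen exactly once, in some order. Floating point model with unit roundoff $u$: $\mathrm{fl}(x\,\mathrm{op}\,y)=(x\,\mathrm{op}\,y)(1+\delta_1)=(x\,\mathrm{op}\,y)/(1+\delta_2)$, $|\delta_1|,|\delta_2|\le u$, $\mathrm{op}\in\{+,-,*,/\}$; $\mathrm{fl}(\sqrt x)=\sqrt x(1+\delta)$, $|\delta|\le u$. $\tilde\gamma_j:=(1-u)^{-wj}-1$, where $w>0$ is a fixed small integer constant (not depending on the matrix, its order, or $u$) whose exact value is unimportant. Jacobi rotation: for $p<q$ and $c^2+s^2=1$ (exact rotations), $J(p,q;c,s)$ is the identity matrix except that its $(p,p)$ and $(q,q)$ entries are $c$, its $(p,q)$ entry is $s$, its $(q,p)$ entry is $-s$; the same notation is used with computed $\hat c,\hat s$. The exact Jacobi rotation for a symmetric $A$ and the pair $(p,q)$ has $c=(1+t^2)^{-1/2}$, $s=tc$, with $t=1/(\mu+\sqrt{1+\mu^2})$ if $\mu\ge0$, $t=1/(\mu-\sqrt{1+\mu^2})$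 if $\mu<0$, $\mu=(a_{qq}-a_{pp})/(2a_{pq})$, and $(c,s)=(1,0)$ if $a_{pq}=0$; it makes the $(p,q)$ entry of $J^TAJ$ zero. One floating point step in the $(p,q)$ plane on the symmetric matrix $A_k=(\hat a^{(k)}_{ij})$: $J_k=J(p,q;c_k,s_k)$ denotes the exact Jacobi rotation for $A_k$ and $(p,q)$, and $\hat J_k=J(p,q;\hat c_k,\hat s_k)$ the one computed in floating point, which satisfies $\hat c_k=c_k(1+\theta)$, $\hat s_k=s_k(1+\theta')$ with $|\theta|,|\theta'|\le\tilde\gamma_1$. The computed symmetric matrix $A_{k+1}$ agrees with $A_k$ outside rows and columns $p,q$, and (superscript $(k)$ and subscript $k$ dropped on the right) $\hat a^{(k+1)}_{pj}=\mathrm{fl}(\hat c\hat a_{pj}-\hat s\hat a_{qj})$, $\hat a^{(k+1)}_{qj}=\mathrm{fl}(\hat s\hat a_{pj}+\hat c\hat a_{qj})$ for $j\ne p,q$, $\hat a^{(k+1)}_{pp}=\mathrm{fl}(\hat c(\hat c\hat a_{pp}-\hat s\hat a_{pq})-\hat s(\hat c\hat a_{pq}-\hat s\hat a_{qq}))$, $\hat a^{(k+1)}_{pq}=\mathrm{fl}(\hat s(\hat c\hat a_{pp}-\hat s\hat a_{pq})+\hat c(\hat c\hat a_{pq}-\hat s\hat a_{qq}))$, and $\hat a^{(k+1)}_{qq}$ is computed analogously to $\hat a^{(k+1)}_{pp}$. $G_k$: symmetric $n\times n$ matrix, zero except that its entries at positions $(p,p),(p,q),(q,p),(q,q)$ equal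 those of $A_k$. $H_k$: symmetric $n\times n$ matrix, zero except that $(H_k)_{pj}=(H_k)_{jp}=\hat a^{(k)}_{pj}$ and $(H_k)_{qj}=(H_k)_{jq}=\hat a^{(k)}_{qj}$ for all $j\ne p,q$. Here $(p,q)=(p_k,q_k)$. *)

(* Defs.v *)
From HB Require Import structures.
From mathcomp Require Import all_boot all_order all_algebra.
From mathcomp Require Import reals.
From mathcomp Require Import polyrcf.

Set Implicit Arguments.
Unset Strict Implicit.
Unset Printing Implicit Defensive.
Import Order.TTheory GRing.Theory Num.Theory.
Local Open Scope ring_scope.

Definition frob (R : realType) m n (G : 'M[R]_(m, n)) : R :=
  Num.sqrt (\sum_i \sum_j G i j ^+ 2).

Definition off (R : realType) n (G : 'M[R]_n) : 'M[R]_n :=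
  G - diag_mx (\row_i G i i).

(* Real eigenvalues in nonincreasing order, repeated according to their
   multiplicity as roots of the characteristic polynomial; all n of them when
   G is symmetric.  rootsR lists the distinct real roots increasingly. *)
Definition eigvals (R : realType) n (G : 'M[R]_n) : seq R :=
  rev (flatten [seq nseq (mup x (char_poly G)) x | x <- rootsR (char_poly G)]).

(* Indices start at 0: lambda G i is the (i+1)-st largest eigenvalue. *)
Definition lambda (R : realType) n (G : 'M[R]_n) (i : nat) : R :=
  (eigvals G)`_i.

(* The seed of the minimum is one of the terms as soon as 2 <= n. *)
Definition spectral_gap (R : realType) n (G : 'M[R]_n) : R :=
  \big[Num.min/`|lambda G 0 - lambda G 1|]_(ij : 'I_n * 'I_n | ij.1 != ij.2)
     `|lambda G ij.1 - lambda G ij.2|.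

(* Floating point model.  An expression is a tree of operations, and every node
   carries its own rounding errors: flval u e r says that r is an admissible
   computed value of e.  No particular (nor even deterministic) rounding
   function is assumed, so this covers every arithmetic obeying the model. *)
Inductive fexpr (R : Type) :=
| FVal of R
| FAdd of fexpr R & fexpr R
| FSub of fexpr R & fexpr R
| FMul of fexpr R & fexpr R
| FDiv of fexpr R & fexpr R
| FSqrt of fexpr R.

Declare Scope fl_scope.
Delimit Scope fl_scope with fl.
Notation "x %:V" := (FVal x) (at level 1, left associativity, format "x %:V") : fl_scope.
Notation "a + b" := (FAdd a b) : fl_scope.
Notation "a - b" := (FSub a b) : fl_scope.
Notation "a * b" := (FMul a b) : fl_scope.
Notation "a / b" := (FDiv a b) : fl_scope.

Definition rounds (R : realType) (u z r : R) : Prop :=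
  (exists2 d1, `|d1| <= u & r = z * (1 + d1)) /\
  (exists2 d2, `|d2| <= u & r = z / (1 + d2)).

Fixpoint flval (R : realType) (u : R) (e : fexpr R) (r : R) : Prop :=
  match e with
  | FVal x => r = x
  | FAdd a b => exists x y, [/\ flval u a x, flval u b y & rounds u (x + y) r]
  | FSub a b => exists x y, [/\ flval u a x, flval u b y & rounds u (x - y) r]
  | FMul a b => exists x y, [/\ flval u a x, flval u b y & rounds u (x * y) r]
  | FDiv a b => exists x y,
      [/\ flval u a x, flval u b y, y != 0 & rounds u (x / y) r]
  | FSqrt a => exists x,
      [/\ flval u a x, 0 <= x
        & exists2 d, `|d| <= u & r = Num.sqrt x * (1 + d)]
  end.

Definition gammat (R : realType) (w : nat) (u : R) (j : nat) : R :=
  (1 - u) ^- (w * j) - 1.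

Definition jacobi_t (R : realType) n (A : 'M[R]_n) (p q : 'I_n) : R :=
  let mu := (A q q - A p p) / (2 * A p q) in
  if 0 <= mu then 1 / (mu + Num.sqrt (1 + mu ^+ 2))
  else 1 / (mu - Num.sqrt (1 + mu ^+ 2)).

Definition jacobi_c (R : realType) n (A : 'M[R]_n) (p q : 'I_n) : R :=
  if A p q == 0 then 1 else (Num.sqrt (1 + jacobi_t A p q ^+ 2))^-1.

Definition jacobi_s (R : realType) n (A : 'M[R]_n) (p q : 'I_n) : R :=
  if A p q == 0 then 0 else jacobi_t A p q * jacobi_c A p q.

Definition fl_rotation (R : realType) (w : nat) (u : R) n
    (A : 'M[R]_n) (p q : 'I_n) (ch sh : R) : Prop :=
  (exists2 th, `|th| <= gammat w u 1 & ch = jacobi_c A p q * (1 + th)) /\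
  (exists2 th', `|th'| <= gammat w u 1 & sh = jacobi_s A p q * (1 + th')).

(* B is a computed value of J^T A J, where J is the identity except for the
   entries J p p = J q q = ch, J p q = sh and J q p = - sh.  The rows p, q
   outside the 2 x 2 block are computed, the columns follow by symmetry. *)
Definition fl_update (R : realType) (u : R) n
    (A : 'M[R]_n) (p q : 'I_n) (ch sh : R) (B : 'M[R]_n) : Prop :=
  let c := (ch%:V)%fl in
  let s := (sh%:V)%fl in
  let app := ((A p p)%:V)%fl in
  let apq := ((A p q)%:V)%fl in
  let aqq := ((A q q)%:V)%fl in
  [/\ B^T = B,
      forall i j, i != p -> i != q -> j != p -> j != q -> B i j = A i j,
      forall j, j != p -> j != q ->
        flval u (c * (A p j)%:V - s * (A q j)%:V)%fl (B p j) /\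
        flval u (s * (A p j)%:V + c * (A q j)%:V)%fl (B q j)
    & [/\ flval u (c * (c * app - s * apq) - s * (c * apq - s * aqq))%fl
            (B p p),
          flval u (s * (c * app - s * apq) + c * (c * apq - s * aqq))%fl
            (B p q)
        & flval u (s * (s * app + c * apq) + c * (s * apq + c * aqq))%fl
            (B q q)]].

Definition fl_jacobi_step (R : realType) (w : nat) (u : R) n
    (A : 'M[R]_n) (p q : 'I_n) (B : 'M[R]_n) : Prop :=
  exists ch sh, fl_rotation w u A p q ch sh /\ fl_update u A p q ch sh B.

Definition npairs (n : nat) : nat := (n * n.-1) %/ 2.

Definition general_cyclic_order n (p q : nat -> 'I_n) : Prop :=
  (forall k, (p k < q k)%N) /\
  (forall (sweep : nat) (i j : 'I_n), (i < j)%N ->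
     exists! k : 'I_(npairs n),
       p (sweep * npairs n + k)%N = i /\ q (sweep * npairs n + k)%N = j).

Definition Gpart (R : realType) n (A : 'M[R]_n) (p q : 'I_n) : 'M[R]_n :=
  \matrix_(i, j)
    if (i \in [:: p; q]) && (j \in [:: p; q]) then A i j else 0.

(* (+) is exclusive or: exactly one of the two indices lies in {p, q}. *)
Definition Hpart (R : realType) n (A : 'M[R]_n) (p q : 'I_n) : 'M[R]_n :=
  \matrix_(i, j)
    if (i \in [:: p; q]) (+) (j \in [:: p; q]) then A i j else 0.

Definition varphi (R : realType) n (A : 'M[R]_n) (p q : 'I_n) : R :=
  Num.sqrt ((6 + 4 * Num.sqrt 2) * frob (Gpart A p q) ^+ 2
            + 2 * frob (Hpart A p q) ^+ 2).

(* In both extrema the seed is the term k = 0 of the range, which is nonempty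
   as soon as 2 <= n. *)
Definition alpha1 (R : realType) (w : nat) (u : R) n
    (A : nat -> 'M[R]_n) (p q : nat -> 'I_n) : R :=
  let N := npairs n in
  let H k := frob (Hpart (A k) (p k) (q k)) in
  (1 + gammat w u 2) ^+ (2 * n - 4) * Num.sqrt (2 * N%:R) *
  ((\big[Num.max/H 0%N]_(k < N) H k) /
   ((\big[Num.min/spectral_gap (A 0%N)]_(k < N) spectral_gap (A k))
      * frob (off (A 0%N)))).

Definition beta1 (R : realType) (w : nat) (u : R) n
    (A : nat -> 'M[R]_n) (p q : nat -> 'I_n) : R :=
  let N := npairs n in
  let G k := frob (Gpart (A k) (p k) (q k)) in
  let H k := frob (Hpart (A k) (p k) (q k)) in
  alpha1 w u A p q *
    (\sum_(k < N) H k ^+ 2 + (\sum_(k < N) G k ^+ 2) * gammat w u 4) +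
  (1 + gammat w u 2) ^+ (2 * n - 4) * Num.sqrt (2 * \sum_(k < N) G k ^+ 2).

(* Main.v *)
Require Import Defs.
From mathcomp Require Import all_boot all_order all_algebra.
From mathcomp Require Import perm.
From mathcomp Require Import reals complex polyrcf.
From mathcomp Require Import ring lra zify.

(** Why the theorem holds.  In a sweep each off-diagonal entry is annihilated
once.  Later rotations only refill it: a rotation meeting it in one index
replaces it by c x - s y, where y is another off-diagonal entry, and |c| <= 1,
so it gains at most |s_k| |y|.  At step k the entries y are those of H_k in
another order, so in the Frobenius norm the refilling at step k is at most
|s_k| ||H_k||_F, and in exact arithmetic ||off(A_N)||_F <= sum_k |s_k| ||H_k||_F.
In floating point every such update also costs a factor 1 + gamma_2; the bound
is followed entry by entry because a given entry shares exactly one index with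
only 2(n-2) pairs of the sweep, hence the exponent 2n-4, and annihilation
leaves a residual of size ||G_k||_F gamma_4.  This is near_rotation_entry,
entry_after_pivot, sweep_shares_one and sweep_off_le.

The angles are small.  With a_k the pivot of step k,
|s_k| |a_pp - a_qq| <= |a_k|, and Weyl's inequality applied to A_k and its
diagonal gives |a_pp - a_qq| >= d(A_k) - 2 ||off(A_k)||_F >= d(A_k) / 2, so
|s_k| <= 2 |a_k| / d(A_k) (jacobi_s_le).  Each step removes 2 a_k^2 from
||off||_F^2 up to rounding, whence 2 sum_k a_k^2 <= Q with
Q = ||off(A_0)||_F^2 + gamma_4 sum_k ||H_k||_F^2 + gamma_4^2 sum_k ||G_k||_F^2
(sum_sqr_pivots).  Cauchy-Schwarz turns sum_k |s_k| ||H_k||_F into a multiple of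
sqrt(2N) sqrt(Q) (sweep_angles_le), and sqrt(Q) <= Q / ||off(A_0)||_F as
Q >= ||off(A_0)||_F^2; this is where the bound becomes quadratic.

The angle bound needs ||off(A_k)||_F < d(A_k) / 4 at every step.  The computed
A_(k+1) is within phi_k gamma_4 of an orthogonal conjugate of A_k, so by Weyl's
inequality d drops by at most 2 phi_k gamma_4, while the size of the pivot
forces ||off||_F to drop by at least phi_k gamma_4 / 2 (off_stays_below_gap).

Weyl's inequality (weyl) is derived from the spectral theorem over the complex
numbers.  The constant w >= 6 makes all rounding errors of a step fit into
(2/3) gamma_2 for the rows and (2/3) gamma_4 for the pivot block; the factor 2/3
satisfies 2 (2/3)^2 <= 1, which absorbs the square roots of 2 met on the way. *)

Set Implicit Arguments.
Unset Strict Implicit.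
Unset Printing Implicit Defensive.
Import Order.TTheory GRing.Theory Num.Theory.
Local Open Scope ring_scope.

(** * Eigenvalues of a symmetric matrix and Weyl's inequality *)

Lemma char_poly_conj (F : comNzRingType) n (A P Q : 'M[F]_n) :
  Q *m P = 1%:M -> char_poly (Q *m A *m P) = char_poly A.
Proof.
move=> QP; rewrite /char_poly.
have -> : char_poly_mx (Q *m A *m P)
    = map_mx polyC Q *m char_poly_mx A *m map_mx polyC P.
  rewrite /char_poly_mx mulmxBr mulmxBl -!map_mxM /=.
  by rewrite scalar_mxC -[_ *m _ *m map_mx _ P]mulmxA -map_mxM /= QP map_scalar_mx mulmx1.
rewrite !det_mulmx mulrAC -det_mulmx -map_mxM QP map_scalar_mx det1.
by rewrite mul1r.
Qed.

(** Counting multiplicities with [mup] on the distinct roots is the same as listing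
the factors of a split characteristic polynomial. *)
Lemma perm_eigvals (R : realType) n (A : 'M[R]_n) (s : seq R) :
  char_poly A = \prod_(x <- s) ('X - x%:P) -> perm_eq (eigvals A) s.
Proof.
move=> charA; rewrite /eigvals perm_rev.
apply: (perm_trans _ (perm_count_undup s)).
rewrite (eq_map (fun x => congr1 (fun m => nseq m x)
  (etrans (congr1 (mup x) charA) (mu_prod_XsubC x s)))).
apply/perm_flatten/perm_map; apply: uniq_perm; rewrite ?undup_uniq //.
  exact: uniq_roots.
move=> x; rewrite -roots_on_rootsR ?monic_neq0 ?char_poly_monic //.
by rewrite charA root_prod_XsubC mem_undup.
Qed.

Lemma sorted_eigvals (R : realType) n (A : 'M[R]_n) :
  sorted (fun x y => y <= x) (eigvals A).
Proof.
rewrite /eigvals rev_sorted.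
have := sorted_roots (- cauchy_bound (char_poly A)) (cauchy_bound (char_poly A))
  (char_poly A).
rewrite -/(rootsR _) (sorted_pairwise lt_trans) (sorted_pairwise le_trans).
elim: (rootsR _) => //= x r IH /andP[xr rr].
rewrite pairwise_cat IH // andbT; apply/andP; split.
  apply/allrelP=> y z; rewrite mem_nseq => /andP[_ /eqP->].
  case/flattenP=> t /mapP[z' z'r ->]; rewrite mem_nseq => /andP[_ /eqP->].
  exact/ltW/(allP xr).
elim: (mup _ _) => //= m ->; rewrite andbT; apply/allP => y.
by rewrite mem_nseq => /andP[_ /eqP->].
Qed.

Lemma lambda_nonincreasing (R : realType) n (A : 'M[R]_n) i j :
  (i <= j)%N -> (j < size (eigvals A))%N -> lambda A j <= lambda A i.
Proof.
move=> ij js.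
have := @sorted_leq_nth _ (fun x y : R => y <= x) _ _ 0 _ (sorted_eigvals A).
apply=> //.
- by move=> y x z h1 h2; apply: le_trans h2 h1.
- by rewrite inE (leq_ltn_trans ij).
Qed.

(** [lambda A] numbers the roots in order; any other numbering [d] of the same roots
differs from it by a permutation. *)
Lemma eigvals_perm (R : realType) n (A : 'M[R]_n) (d : 'I_n -> R) :
  char_poly A = \prod_i ('X - (d i)%:P) ->
  size (eigvals A) = n /\ exists s : 'S_n, forall i, d i = lambda A (s i).
Proof.
move=> charA.
have pm : perm_eq (eigvals A) [seq d i | i <- enum 'I_n].
  by apply: perm_eigvals; rewrite charA big_map big_enum.
have sz : size (eigvals A) = n by rewrite (perm_size pm) size_map size_enum_ord.
split=> //.
have szb : size (eigvals A) == n by apply/eqP.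
rewrite perm_sym (_ : eigvals A = Tuple szb) // in pm.
have /tuple_permP[s es] := pm; exists s => i.
have := congr1 (fun t => nth 0 t i) es;
rewrite (nth_map i) ?size_enum_ord // nth_ord_enum => ->.
by rewrite (nth_map i) ?size_enum_ord // nth_ord_enum (tnth_nth 0).
Qed.

Section Weyl.
Local Open Scope sesquilinear_scope.

(** Over the complex numbers [A] is Hermitian, hence unitarily diagonalizable with
real eigenvalues; the factorization of its characteristic polynomial then
descends to the reals. *)
Lemma symmetric_spectral (R : realType) n (A : 'M[R]_n) :
  A^T = A -> exists (P : 'M[R[i]]_n) (d : 'I_n -> R),
    [/\ P \is unitarymx,
       map_mx (real_complex R) A = P ^t* *m diag_mx (\row_i (d i)%:C%C) *m P
     & char_poly A = \prod_i ('X - (d i)%:P)].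
Proof.
move=> symA; set AC := map_mx _ A.
have ACreal : AC \is a realmx.
  by apply/mxOverP=> i j; rewrite mxE; apply/complex_realP; exists (A i j).
have hermA : AC \is hermsymmx.
  apply: realsym_hermsym => //; apply/is_hermitianmxP.
  by rewrite expr0 scale1r map_mx_id // /AC map_trmx symA.
have /orthomx_spectralP specA := hermitian_normalmx hermA.
have Dreal := hermitian_spectral_diag_real hermA.
have Uni := spectral_unitarymx AC.
exists (spectralmx AC), (fun i => complex.Re (spectral_diag AC 0 i)).
have De : \row_i (complex.Re (spectral_diag AC 0 i))%:C%C = spectral_diag AC.
  by apply/rowP=> i; rewrite mxE RRe_real // (mxOverP Dreal).
split=> //; first by rewrite De [LHS]specA invmx_unitary.
apply: (map_poly_inj (real_complex R)).
rewrite map_char_poly /= -/AC [in LHS]specA char_poly_conj; last first.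
  by rewrite mulVmx ?spectral_unit.
rewrite char_poly_trig ?diag_mx_is_trig // rmorph_prod; apply: eq_bigr => i _.
by rewrite rmorphB /= map_polyX map_polyC /= -De !mxE eqxx mulr1n.
Qed.

(** Nonnegativity of the sum of the squares of [Y x_i - S y_i], with
[Y = sum y_i^2] and [S = sum x_i y_i]. *)
Lemma cauchy_schwarz_sum (R : realFieldType) (I : finType) (x y : I -> R) :
  (\sum_i x i * y i) ^+ 2 <= (\sum_i x i ^+ 2) * (\sum_i y i ^+ 2).
Proof.
set X := \sum_i x i ^+ 2; set Y := \sum_i y i ^+ 2; set S := \sum_i _.
have Y0 : 0 <= Y by apply: sumr_ge0 => i _; exact: sqr_ge0.
have : 0 <= \sum_i (Y * x i - S * y i) ^+ 2 by apply: sumr_ge0 => i _; exact: sqr_ge0.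
have expand a b : \sum_i (a * x i - b * y i) ^+ 2
    = a ^+ 2 * X - 2 * a * b * S + b ^+ 2 * Y.
  rewrite /X /Y /S !big_distrr /= -sumrB -big_split /=.
  by apply: eq_bigr => i _; ring.
rewrite expand (_ : _ + _ = Y * (X * Y - S ^+ 2)); last by ring.
move: Y0; rewrite le_eqVlt => /predU1P[Y0 _|Y0].
  have S0 : S = 0.
    apply: big1 => i _; have /eqP := esym Y0.
    rewrite psumr_eq0 => [/allP/(_ i (mem_index_enum _))|j _]; last exact: sqr_ge0.
    by rewrite /= sqrf_eq0 => /eqP ->; rewrite mulr0.
  by rewrite S0 -Y0 expr0n mulr0.
by rewrite pmulr_rge0 // subr_ge0.
Qed.

Lemma frobE (R : realType) m n (G : 'M[R]_(m, n)) :
  frob G ^+ 2 = \sum_i \sum_j G i j ^+ 2.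
Proof.
rewrite sqr_sqrtr //; apply: sumr_ge0 => i _; apply: sumr_ge0 => j _.
exact: sqr_ge0.
Qed.

Lemma frob_ge0 (R : realType) m n (G : 'M[R]_(m, n)) : 0 <= frob G.
Proof. exact: sqrtr_ge0. Qed.

Lemma quadratic_form_diag (C : numClosedFieldType) n (P : 'M[C]_n) (d : 'I_n -> C)
    (v : 'rV[C]_n) :
  (v *m (P ^t* *m diag_mx (\row_i d i) *m P) *m v ^t*) 0 0
    = \sum_j d j * `|(v *m P ^t*) 0 j| ^+ 2.
Proof.
have -> : v *m (P ^t* *m diag_mx (\row_i d i) *m P) *m v ^t*
   = (v *m P ^t*) *m diag_mx (\row_i d i) *m (v *m P ^t*) ^t*.
  by rewrite trmx_mul map_mxM !trmxCK !mulmxA.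
rewrite mxE; apply: eq_bigr => j _; rewrite mul_mx_diag !mxE normCK.
by rewrite mulrAC mulrC.
Qed.

Lemma unitary_norm (C : numClosedFieldType) n (P : 'M[C]_n) (v : 'rV[C]_n) :
  P \is unitarymx ->
  \sum_j `|(v *m P ^t*) 0 j| ^+ 2 = \sum_j `|v 0 j| ^+ 2.
Proof.
move=> Punit.
have := quadratic_form_diag P (fun=> 1) v.
rewrite (_ : \row__ _ = const_mx 1); last by apply/rowP=> j; rewrite !mxE.
rewrite diag_const_mx mulmx1 -invmx_unitary // mulVmx ?unitarymx_unit // mulmx1.
rewrite mxE (eq_bigr (fun j => `|v 0 j| ^+ 2)); last by move=> j _; rewrite !mxE normCK.
by move=> ->; apply: eq_bigr => j _; rewrite mul1r invmx_unitary.
Qed.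

(** The operator norm is at most the Frobenius norm, by Cauchy-Schwarz over the
pairs of indices. *)
Lemma quadratic_form_le (R : realType) n (E : 'M[R]_n) (v : 'rV[R[i]]_n) :
  `|(v *m map_mx (real_complex R) E *m v ^t*) 0 0|
    <= (frob E)%:C%C * \sum_j `|v 0 j| ^+ 2.
Proof.
pose r j : R := complex.Re `|v 0 j|.
have rE j : `|v 0 j| = (r j)%:C%C by rewrite /r RRe_real // normr_real.
have r0 j : 0 <= r j by rewrite -ler0c -rE.
have -> : (frob E)%:C%C * \sum_j `|v 0 j| ^+ 2 = (frob E * \sum_j r j ^+ 2)%:C%C.
  rewrite rmorphM rmorph_sum /=; congr (_ * _); apply: eq_bigr => j _.
  by rewrite rE rmorphXn.
rewrite mxE (@le_trans _ _ (\sum_i \sum_j `|E i j| * (r i * r j))%:C%C) //.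
  rewrite (eq_bigr (fun j => \sum_i v 0 i * (E i j)%:C%C * (v 0 j)^*%C)); last first.
    by move=> j _; rewrite !mxE mulr_suml; apply: eq_bigr => i _; rewrite mxE.
  rewrite exchange_big /= (le_trans (ler_norm_sum _ _ _)) // rmorph_sum /=.
  apply: ler_sum => i _.
  rewrite (le_trans (ler_norm_sum _ _ _)) // rmorph_sum /=.
  apply: ler_sum => j _.
  rewrite !normrM normcJ !rE normc_def /= expr0n addr0 sqrtr_sqr -!rmorphM lecR.
  by rewrite mulrCA mulrA.
rewrite lecR pair_big /=.
set S := \sum_(ij | _) _; set T := \sum_j _.
have T0 : 0 <= T by apply: sumr_ge0 => j _; exact: sqr_ge0.
have S0 : 0 <= S by apply: sumr_ge0 => ij _; rewrite !mulr_ge0.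
rewrite -(ler_pXn2r (_ : 0 < 2)%N) ?nnegrE ?mulr_ge0 ?frob_ge0 //.
rewrite (le_trans (cauchy_schwarz_sum _ _)) // exprMn frobE.
apply: ler_pM.
- by apply: sumr_ge0 => ij _; exact: sqr_ge0.
- by apply: sumr_ge0 => ij _; exact: sqr_ge0.
- by rewrite pair_big /= ler_sum // => ij _; rewrite real_normK ?num_real.
rewrite le_eqVlt; apply/orP; left; apply/eqP.
rewrite -(pair_big xpredT xpredT (fun i j => (r i * r j) ^+ 2)) /=.
rewrite expr2 big_distrl /=; apply: eq_bigr => i _.
by rewrite big_distrr /=; apply: eq_bigr => j _; rewrite exprMn.
Qed.

Lemma sorted_spectral (R : realType) n (A : 'M[R]_n) :
  A^T = A -> exists (P : 'M[R[i]]_n) (s : 'S_n),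
    P \is unitarymx /\
    map_mx (real_complex R) A
      = P ^t* *m diag_mx (\row_i (lambda A (s i))%:C%C) *m P.
Proof.
move=> /symmetric_spectral[P [d [uniP specA charA]]].
have [_ [s ds]] := eigvals_perm charA.
exists P, s; split; first exact: uniP.
have <- : \row_i (d i)%:C%C = \row_i (lambda A (s i))%:C%C.
  by apply/rowP=> i; rewrite !mxE ds.
exact: specA.
Qed.

Lemma size_eigvals (R : realType) n (A : 'M[R]_n) :
  A^T = A -> size (eigvals A) = n.
Proof.
move=> /symmetric_spectral[P [d [_ _ charA]]].
by have [] := eigvals_perm charA.
Qed.

Lemma singular_left_kernel (F : fieldType) n (N : 'M[F]_n) (i : 'I_n) :
  (forall k, N k i = 0) -> exists2 v : 'rV_n, v != 0 & v *m N = 0.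
Proof.
move=> Ni0; have : kermx N != 0.
  rewrite kermx_eq0 row_free_unit; apply: contraL (oner_neq0 F) => Nu.
  have /(congr1 (mulmx (invmx N))) : N *m delta_mx i (0 : 'I_1) = 0.
    apply/colP=> k; rewrite !mxE (bigD1 i) //= big1 ?addr0.
      by rewrite Ni0 mul0r.
    by move=> j ji; rewrite mxE (negPf ji) mulr0.
  rewrite mulKmx // mulmx0 => /colP/(_ i); rewrite !mxE !eqxx /= => /eqP.
  by rewrite negbK.
by case/rowV0Pn=> v /sub_kermxP vN v0; exists v.
Qed.

(** Courant-Fischer in the form of one linear system.  Requiring a vector to be
orthogonal to the eigenvectors of [A] numbered after [i] and to those of [B]
numbered before [i] is only [n - 1] equations, so a nonzero solution [v] exists.
Its quadratic form is at least [lambda A i] for [A] and at most [lambda B i] for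
[B], per unit of squared norm. *)
Lemma weyl_le (R : realType) n (A B : 'M[R]_n) (i : 'I_n) :
  A^T = A -> B^T = B -> lambda A i <= lambda B i + frob (A - B).
Proof.
move=> symA symB.
have [P [s [uniP specA]]] := sorted_spectral symA.
have [Q [t [uniQ specB]]] := sorted_spectral symB.
(* Column [i] of [N] is zero: this is the missing equation. *)
pose N : 'M_n := \matrix_(k, m)
  if (m < i)%N then (Q ^t*) k ((t^-1)%g m)
  else if (i < m)%N then (P ^t*) k ((s^-1)%g m) else 0.
have [|v v0 vN] := @singular_left_kernel _ _ N i.
  by move=> k; rewrite mxE ltnn.
have yv j : (i < s j)%N -> (v *m P ^t*) 0 j = 0.
  move=> ij; transitivity ((v *m N) 0 (s j)); last by rewrite vN mxE.
  rewrite !mxE; apply: eq_bigr => k _; congr (_ * _).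
  by rewrite [RHS]mxE ltnNge (ltnW ij) ij permK.
have zv j : (t j < i)%N -> (v *m Q ^t*) 0 j = 0.
  move=> ij; transitivity ((v *m N) 0 (t j)); last by rewrite vN mxE.
  rewrite !mxE; apply: eq_bigr => k _; congr (_ * _).
  by rewrite [RHS]mxE ij permK.
have lamA := lambda_nonincreasing (A := A); rewrite size_eigvals // in lamA.
have lamB := lambda_nonincreasing (A := B); rewrite size_eigvals // in lamB.
set nv := \sum_j `|v 0 j| ^+ 2.
have nv0 : 0 < nv.
  rewrite lt_def sumr_ge0 ?andbT => [|j _]; last exact: exprn_ge0.
  apply: contra v0; rewrite psumr_eq0 => [|j _]; last exact: exprn_ge0.
  move=> /allP h; apply/eqP/rowP=> j; rewrite mxE; apply/eqP.
  by have := h j (mem_index_enum _); rewrite sqrf_eq0 normr_eq0.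
pose form (M : 'M[R]_n) := (v *m map_mx (real_complex R) M *m v ^t*) 0 0.
have lowA : (lambda A i)%:C%C * nv <= form A.
  rewrite /form specA quadratic_form_diag /nv -(unitary_norm v uniP) mulr_sumr.
  apply: ler_sum => j _; have [/yv ->|sji] := ltnP i (s j).
    by rewrite normr0 expr0n !mulr0.
  by rewrite ler_wpM2r ?exprn_ge0 // lecR lamA.
have upB : form B <= (lambda B i)%:C%C * nv.
  rewrite /form specB quadratic_form_diag /nv -(unitary_norm v uniQ) mulr_sumr.
  apply: ler_sum => j _; have [/zv ->|sji] := ltnP (t j) i.
    by rewrite normr0 expr0n !mulr0.
  by rewrite ler_wpM2r ?exprn_ge0 // lecR lamB.
have formB : form A - form B = form (A - B).
  by rewrite [in RHS]/form map_mxB mulmxBr mulmxBl [RHS]mxE [X in _ = _ + X]mxE.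
have rlam (x : R) : (x%:C%C * nv) \is Num.real.
  by apply: realM; [apply/complex_realP; exists x | exact: gtr0_real].
have realAB : form (A - B) \is Num.real.
  rewrite -formB; apply: realB; last by rewrite (ler_real upB) rlam.
  by rewrite -(ler_real lowA) rlam.
have le1 : form A - form B <= (frob (A - B))%:C%C * nv.
  by rewrite formB (le_trans (real_ler_norm realAB)) // quadratic_form_le.
rewrite -lecR -(ler_pM2r nv0) rmorphD mulrDl /=.
rewrite (le_trans lowA) // -lerBlDl; apply: le_trans le1.
by rewrite lerB.
Qed.

Lemma weyl (R : realType) n (A B : 'M[R]_n) (i : 'I_n) :
  A^T = A -> B^T = B -> `|lambda A i - lambda B i| <= frob (A - B).
Proof.
move=> symA symB; have AB := weyl_le i symA symB.
have BA := weyl_le i symB symA.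
have frobN : frob (B - A) = frob (A - B).
  congr Num.sqrt; apply: eq_bigr => k _; apply: eq_bigr => j _.
  by rewrite !mxE -sqrrN opprB.
rewrite frobN in BA; rewrite ler_norml; apply/andP; split; lra.
Qed.

End Weyl.

Lemma spectral_gap_le (R : realType) n (A : 'M[R]_n) (i j : 'I_n) :
  i != j -> spectral_gap A <= `|lambda A i - lambda A j|.
Proof. by move=> ij; apply: (@bigmin_le_cond _ _ _ _ (i, j)). Qed.

Lemma le_spectral_gap (R : realType) n (A : 'M[R]_n) (x : R) :
  (2 <= n)%N ->
  (forall i j : 'I_n, i != j -> x <= `|lambda A i - lambda A j|) ->
  x <= spectral_gap A.
Proof.
move=> n2 h; apply: le_bigmin; last by move=> [i j] /= ij; exact: h.
exact: (h (Ordinal (ltnW n2)) (Ordinal n2)).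
Qed.

(** By Weyl's inequality both eigenvalues of a difference move by at most the norm
of the perturbation. *)
Lemma spectral_gap_perturb (R : realType) n (A B : 'M[R]_n) :
  (2 <= n)%N -> A^T = A -> B^T = B ->
  spectral_gap A - 2 * frob (A - B) <= spectral_gap B.
Proof.
move=> n2 symA symB; apply: le_spectral_gap => // i j ij.
have := spectral_gap_le A ij; have := weyl i symA symB; have := weyl j symA symB.
move: (lambda A i) (lambda A j) (lambda B i) (lambda B j) => a b c d.
rewrite !ler_norml => /andP[h1 h2] /andP[h3 h4].
rewrite !ler_normr => /orP[h5|h5]; apply/orP; [left|right]; lra.
Qed.

(** Weyl's inequality between [A] and its diagonal: the diagonal entries are
eigenvalues of the latter, numbered by some permutation. *)
Lemma diagonal_gap (R : realType) n (A : 'M[R]_n) (p q : 'I_n) :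
  (2 <= n)%N -> A^T = A -> p != q ->
  spectral_gap A - 2 * frob (off A) <= `|A p p - A q q|.
Proof.
move=> n2 symA pq; pose D : 'M[R]_n := diag_mx (\row_i A i i).
have symD : D^T = D by rewrite tr_diag_mx.
have charD : char_poly D = \prod_i ('X - (A i i)%:P).
  rewrite char_poly_trig ?diag_mx_is_trig //; apply: eq_bigr => i _.
  by rewrite !mxE eqxx mulr1n.
have [_ [s sD]] := eigvals_perm charD.
rewrite !sD; apply: le_trans (spectral_gap_perturb n2 symA symD) _.
by apply: spectral_gap_le; apply: contra pq => /eqP/perm_inj ->.
Qed.

Lemma lambda_conj (R : realType) n (A P Q : 'M[R]_n) i :
  Q *m P = 1%:M -> lambda (Q *m A *m P) i = lambda A i.
Proof. by move=> QP; rewrite /lambda /eigvals char_poly_conj. Qed.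

Lemma spectral_gap_conj (R : realType) n (A P Q : 'M[R]_n) :
  Q *m P = 1%:M -> spectral_gap (Q *m A *m P) = spectral_gap A.
Proof.
move=> QP; have lam i := lambda_conj A i QP.
by rewrite /spectral_gap (lam 0%N) (lam 1%N); apply: eq_bigr => ij _; rewrite !lam.
Qed.

(** * Accumulation of rounding errors *)

(** [r] is a computed value of [z] with relative error [X - 1], measured not against
[`|z|] but against [a], the value of the same expression with all its terms
replaced by absolute values; this is what survives cancellation. *)
Definition approx (R : realType) (X z a r : R) :=
  `|z| <= a /\ `|r - z| <= (X - 1) * a.

Lemma approx_exact (R : realType) (z : R) : approx 1 z `|z| z.
Proof. by split; rewrite // !subrr normr0 mul0r. Qed.

Lemma approx_rel (R : realType) (X Y z a r d : R) :
  1 <= X -> approx X z a r -> `|d| <= Y - 1 -> approx (X * Y) z a (r * (1 + d)).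
Proof.
move=> X1 [za rz] dY; split=> //.
have a0 : 0 <= a := le_trans (normr_ge0 z) za.
have rX : `|r| <= X * a.
  have -> : r = (r - z) + z by rewrite subrK.
  by rewrite (le_trans (ler_normD _ _)) //; nra.
have -> : r * (1 + d) - z = (r - z) + r * d by ring.
rewrite (le_trans (ler_normD _ _)) // normrM.
have : `|r| * `|d| <= X * a * (Y - 1) by rewrite ler_pM.
by nra.
Qed.

Lemma approx_scale (R : realType) (X c z a r : R) :
  approx X z a r -> approx X (c * z) (`|c| * a) (c * r).
Proof.
move=> [za rz]; split; first by rewrite normrM ler_wpM2l.
by rewrite -mulrBr normrM mulrCA ler_wpM2l.
Qed.

Lemma approx_add (R : realType) (X z z' a a' r r' : R) :
  approx X z a r -> approx X z' a' r' -> approx X (z + z') (a + a') (r + r').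
Proof.
move=> [za rz] [za' rz']; split.
  by rewrite (le_trans (ler_normD _ _)) // lerD.
by rewrite opprD addrACA (le_trans (ler_normD _ _)) // mulrDr lerD.
Qed.

Lemma approx_opp (R : realType) (X z a r : R) :
  approx X z a r -> approx X (- z) a (- r).
Proof. by move=> [za rz]; split; rewrite -?opprD normrN. Qed.

(** The natural unit of relative error is the amplification [M = 1 / (1 - u)]:
[k] successive roundings cost a factor [M ^ k], and [gammat w u j] is
[M ^ (w * j) - 1]. *)
Section FloatingPoint.
Variables (R : realType) (u : R).
Hypotheses (u_gt0 : 0 < u) (u_lt1 : u < 1).
Let M : R := (1 - u)^-1.

Lemma amp_ge1 : 1 <= M.
Proof. by rewrite invf_ge1 ?subr_gt0 // gerBl ltW. Qed.

Lemma unit_roundoff_le_amp : u <= M - 1.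
Proof.
have M1 := amp_ge1; have : M * (1 - u) = 1 by rewrite mulVf ?gt_eqF ?subr_gt0.
by nra.
Qed.

Lemma gammatE w j : gammat w u j = M ^+ (w * j) - 1.
Proof. by rewrite /gammat exprVn. Qed.

Lemma approx_round (X z a r x : R) :
  1 <= X -> approx X z a x -> rounds u x r -> approx (X * M) z a r.
Proof.
move=> X1 xz [[d du ->] _]; apply: approx_rel => //.
exact: le_trans du unit_roundoff_le_amp.
Qed.

Lemma approx_flmul (X Y c ch th z a r : R) (e : fexpr R) :
  1 <= X -> 1 <= Y -> ch = c * (1 + th) -> `|th| <= Y - 1 ->
  (forall x, flval u e x -> approx X z a x) ->
  flval u (ch%:V * e)%fl r -> approx (X * Y * M) (c * z) (`|c| * a) r.
Proof.
move=> X1 Y1 -> thY ez [_ [x [-> /ez xz]]]; apply: approx_round.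
  by rewrite -(mulr1 1) ler_pM.
rewrite mulrAC -mulrA; apply: approx_scale.
by rewrite mulrC mulrC; exact: approx_rel.
Qed.

Lemma approx_fladd (X z z' a a' r : R) (e e' : fexpr R) :
  1 <= X ->
  (forall x, flval u e x -> approx X z a x) ->
  (forall x, flval u e' x -> approx X z' a' x) ->
  flval u (e + e')%fl r -> approx (X * M) (z + z') (a + a') r.
Proof.
move=> X1 ez ez' [x [y [/ez xz /ez' yz]]]; apply: approx_round => //.
exact: approx_add.
Qed.

Lemma approx_flsub (X z z' a a' r : R) (e e' : fexpr R) :
  1 <= X ->
  (forall x, flval u e x -> approx X z a x) ->
  (forall x, flval u e' x -> approx X z' a' x) ->
  flval u (e - e')%fl r -> approx (X * M) (z - z') (a + a') r.
Proof.
move=> X1 ez ez' [x [y [/ez xz /ez' yz]]]; apply: approx_round => //.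
exact: (approx_add xz (approx_opp yz)).
Qed.

(** Bernoulli's inequality for the exponent 3/2, the room needed to replace the
raw powers of the amplification by fixed fractions of [gammat]. *)
Lemma amp_pow (a b : nat) (X : R) : 1 <= X ->
  (3 * a <= 2 * b)%N -> X ^+ a - 1 <= 2 / 3 * (X ^+ b - 1).
Proof.
move=> X1 ab; set y := X ^+ a; set z := X ^+ b.
have y1 : 1 <= y by rewrite exprn_ege1.
have z1 : 1 <= z by rewrite exprn_ege1.
have yz : y ^+ 3 <= z ^+ 2 by rewrite -!exprM ler_weXn2l // mulnC [(b * _)%N]mulnC.
rewrite leNgt; apply/negP => h.
have zw : z ^+ 2 < ((3 * y - 1) / 2) ^+ 2 by rewrite ltrXn2r //; lra.
have : 0 <= (y - 1) ^+ 2 * (y - 1 / 4) by rewrite mulr_ge0 ?sqr_ge0 //; lra.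
by nra.
Qed.

End FloatingPoint.

(** What rounding leaves of [J^T A J]: the rows are accurate to [mu] and the pivot
block to [nu], both relative to the sums of absolute values.  This hides the
arithmetic from the norm estimates. *)
Definition near_rotation (R : realType) n (A : 'M[R]_n) (p q : 'I_n)
    (c s mu nu : R) (B : 'M[R]_n) : Prop :=
  [/\ B^T = B,
      forall i j, i != p -> i != q -> j != p -> j != q -> B i j = A i j,
      forall j, j != p -> j != q ->
        `|B p j - (c * A p j - s * A q j)|
          <= mu * (`|c| * `|A p j| + `|s| * `|A q j|) /\
        `|B q j - (s * A p j + c * A q j)|
          <= mu * (`|s| * `|A p j| + `|c| * `|A q j|)
    & [/\ `|B p p - (c * (c * A p p - s * A p q) - s * (c * A p q - s * A q q))|
            <= nu * (`|c| * (`|c| * `|A p p| + `|s| * `|A p q|)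
                     + `|s| * (`|c| * `|A p q| + `|s| * `|A q q|)),
          `|B p q - (s * (c * A p p - s * A p q) + c * (c * A p q - s * A q q))|
            <= nu * (`|s| * (`|c| * `|A p p| + `|s| * `|A p q|)
                     + `|c| * (`|c| * `|A p q| + `|s| * `|A q q|))
        & `|B q q - (s * (s * A p p + c * A p q) + c * (s * A p q + c * A q q))|
            <= nu * (`|s| * (`|s| * `|A p p| + `|c| * `|A p q|)
                     + `|c| * (`|s| * `|A p q| + `|c| * `|A q q|))]].

Lemma approx_bound (R : realType) (X Y z a r : R) :
  approx X z a r -> X - 1 <= Y -> `|r - z| <= Y * a.
Proof.
move=> [za rz] XY; apply: le_trans rz _; rewrite ler_wpM2r //.
exact: le_trans (normr_ge0 _) za.
Qed.

(** A row entry undergoes the error of [c] or [s] (amplification [M ^ w]) and two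
roundings; an entry of the block undergoes this twice.  So the exponents are
[w + 2] and [2 w + 4], at most two thirds of [2 w] and [4 w] when [w >= 6]. *)
Lemma fl_jacobi_step_near_rotation (R : realType) (w : nat) (u : R) n
    (A : 'M[R]_n) (p q : 'I_n) (B : 'M[R]_n) :
  0 < u -> u < 1 -> (6 <= w)%N -> fl_jacobi_step w u A p q B ->
  near_rotation A p q (jacobi_c A p q) (jacobi_s A p q)
    (2 / 3 * gammat w u 2) (2 / 3 * gammat w u 4) B.
Proof.
move=> u0 u1 w6 [ch [sh [[[th thg chE] [th' thg' shE]] [symB out rows block]]]].
set M := (1 - u)^-1.
have M1 : 1 <= M by apply: amp_ge1.
have Mn1 k : 1 <= M ^+ k by rewrite exprn_ege1.
rewrite !gammatE -/M muln1 in thg thg' *.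
set c := jacobi_c A p q in chE *; set s := jacobi_s A p q in shE *.
have leaf (x y : R) : flval u (FVal x) y -> approx (M ^+ 0) x `|x| y.
  by move=> /= ->; rewrite expr0; exact: approx_exact.
have mulc k (e : fexpr R) z a r :
    (forall x, flval u e x -> approx (M ^+ k) z a x) ->
    flval u (ch%:V * e)%fl r -> approx (M ^+ (k + w).+1) (c * z) (`|c| * a) r.
  by rewrite exprSr exprD; exact: (approx_flmul u0 u1 (Mn1 k) (Mn1 w) chE thg).
have muls k (e : fexpr R) z a r :
    (forall x, flval u e x -> approx (M ^+ k) z a x) ->
    flval u (sh%:V * e)%fl r -> approx (M ^+ (k + w).+1) (s * z) (`|s| * a) r.
  by rewrite exprSr exprD; exact: (approx_flmul u0 u1 (Mn1 k) (Mn1 w) shE thg').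
have add k (e e' : fexpr R) z z' a a' r :
    (forall x, flval u e x -> approx (M ^+ k) z a x) ->
    (forall x, flval u e' x -> approx (M ^+ k) z' a' x) ->
    flval u (e + e')%fl r -> approx (M ^+ k.+1) (z + z') (a + a') r.
  by rewrite exprSr; exact: (approx_fladd u0 u1 (Mn1 k)).
have sub k (e e' : fexpr R) z z' a a' r :
    (forall x, flval u e x -> approx (M ^+ k) z a x) ->
    (forall x, flval u e' x -> approx (M ^+ k) z' a' x) ->
    flval u (e - e')%fl r -> approx (M ^+ k.+1) (z - z') (a + a') r.
  by rewrite exprSr; exact: (approx_flsub u0 u1 (Mn1 k)).
have fincs : M ^+ (0 + w).+2 - 1 <= 2 / 3 * (M ^+ (w * 2) - 1).
  by apply: amp_pow => //; lia.
have finblock : M ^+ ((0 + w).+2 + w).+2 - 1 <= 2 / 3 * (M ^+ (w * 4) - 1).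
  by apply: amp_pow => //; lia.
have [bpp bpq bqq] := block.
split=> //.
  move=> j jp jq; have [rp rq] := rows j jp jq; split.
    apply: approx_bound fincs; apply: sub rp => x; [apply: mulc|apply: muls]; exact: leaf.
  apply: approx_bound fincs; apply: add rq => x; [apply: muls|apply: mulc]; exact: leaf.
have ccs x y z : flval u (ch%:V * x%:V - sh%:V * y%:V)%fl z ->
    approx (M ^+ (0 + w).+2) (c * x - s * y) (`|c| * `|x| + `|s| * `|y|) z.
  by apply: sub => t; [apply: mulc|apply: muls]; exact: leaf.
have csc x y z : flval u (sh%:V * x%:V + ch%:V * y%:V)%fl z ->
    approx (M ^+ (0 + w).+2) (s * x + c * y) (`|s| * `|x| + `|c| * `|y|) z.
  by apply: add => t; [apply: muls|apply: mulc]; exact: leaf.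
split; apply: approx_bound finblock.
- by apply: sub bpp => x; [apply: mulc|apply: muls]; apply: ccs.
- by apply: add bpq => x; [apply: muls|apply: mulc]; apply: ccs.
- by apply: add bqq => x; [apply: muls|apply: mulc]; apply: csc.
Qed.

Lemma abs_cos_le1 (R : realType) (c s : R) : c ^+ 2 + s ^+ 2 = 1 -> `|c| <= 1.
Proof.
move=> cs; rewrite -(ler_pXn2r (n := 2)) ?nnegrE // expr1n.
by rewrite real_normK ?num_real // -cs lerDl sqr_ge0.
Qed.

(** * The exact Jacobi rotation *)

Section ExactRotation.
Variables (R : realType) (n : nat) (A : 'M[R]_n) (p q : 'I_n).
Local Notation c := (jacobi_c A p q).
Local Notation s := (jacobi_s A p q).

Lemma jacobi_sqr : c ^+ 2 + s ^+ 2 = 1.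
Proof.
rewrite /jacobi_s /jacobi_c; case: ifP => _; first by rewrite expr1n expr0n addr0.
set t := jacobi_t A p q; have t2 := sqr_ge0 t.
have pos : 0 < 1 + t ^+ 2 by rewrite ltr_pwDl.
rewrite exprMn -[X in X + _]mul1r -mulrDl exprVn sqr_sqrtr ?ltW //.
by rewrite mulfV ?gt_eqF.
Qed.

(** [t] is the tangent of the angle: it solves [t^2 + 2 mu t - 1 = 0], here cleared
of the denominator of [mu]. *)
Lemma jacobi_t_root : A p q != 0 ->
  jacobi_t A p q ^+ 2 * A p q = A p q - jacobi_t A p q * (A q q - A p p).
Proof.
move=> apq; rewrite /jacobi_t; set mu := (A q q - A p p) / (2 * A p q).
have -> : A q q - A p p = mu * (2 * A p q) by rewrite divfK // mulf_neq0 ?pnatr_eq0.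
set r := Num.sqrt _.
have r2 : r ^+ 2 = 1 + mu ^+ 2 by rewrite sqr_sqrtr // addr_ge0 ?sqr_ge0.
have r1 : 0 < r by rewrite sqrtr_gt0 ltr_pwDl ?sqr_ge0.
have den x : x != 0 -> x ^+ 2 = 2 * mu * x + 1 ->
    (1 / x) ^+ 2 * A p q = A p q - 1 / x * (mu * (2 * A p q)).
  move=> x0 xE; apply: (mulIf (expf_neq0 2 x0)).
  rewrite mulrBl expr_div_n mulrAC divfK ?expf_neq0 // expr1n mul1r.
  rewrite [in X in _ = X - _]xE -mulrA [X in _ - X](_ : _ = mu * (2 * A p q) * x).
    by ring.
  by rewrite expr2; field.
case: ifP => mu0; apply: den.
- by rewrite gt_eqF // ltr_wpDl.
- by rewrite sqrrD r2; ring.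
- rewrite lt_eqF // subr_lt0 (lt_trans _ r1) // ltNge mu0 //.
- by rewrite sqrrB r2; ring.
Qed.

Lemma jacobi_t_le1 : `|jacobi_t A p q| <= 1.
Proof.
rewrite /jacobi_t; set mu := _ / (2 * _); set r := Num.sqrt _.
have r1 : 1 <= r by rewrite -[X in X <= _]sqrtr1 ler_wsqrtr // lerDl sqr_ge0.
have inv_le1 (x : R) : 1 <= `|x| -> `|1 / x| <= 1.
  by move=> x1; rewrite div1r normfV invf_le1 // (lt_le_trans ltr01).
case: ifPn => mu0; apply: inv_le1; rewrite ler_normr; apply/orP.
  by left; lra.
by right; rewrite -ltNge in mu0; lra.
Qed.

Lemma jacobi_annihilates :
  s * (c * A p p - s * A p q) + c * (c * A p q - s * A q q) = 0.
Proof.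
rewrite /jacobi_s; have [a0|a0] := eqVneq (A p q) 0.
  by rewrite a0; ring.
have root := jacobi_t_root a0; set t := jacobi_t A p q in root *.
set c0 := jacobi_c A p q.
transitivity (c0 ^+ 2 * (A p q - t * (A q q - A p p) - t ^+ 2 * A p q)); first by ring.
by rewrite root; ring.
Qed.

(** The equation for [t] gives [t (a_qq - a_pp) = (1 - t^2) a_pq], and
[`|1 - t^2| <= 1] because the angle is at most [pi / 4]. *)
Lemma jacobi_s_gap : `|s| * `|A p p - A q q| <= `|A p q|.
Proof.
rewrite /jacobi_s; have [a0|a0] := eqVneq (A p q) 0; first by rewrite normr0 mul0r.
have root := jacobi_t_root a0; have t1 := jacobi_t_le1.
have c1 := abs_cos_le1 jacobi_sqr.
set t := jacobi_t A p q in root t1 *.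
have -> : `|t * c| * `|A p p - A q q| = `|c| * `|(1 - t ^+ 2) * A p q|.
  rewrite -!normrM -[LHS]normrN; congr `|_|.
  by rewrite mulrBl mul1r root; ring.
rewrite !normrM mulrA -[leRHS]mul1r ler_wpM2r // -[leRHS]mul1r ler_pM //.
have t2 : t ^+ 2 <= 1 by rewrite -real_normK ?num_real // expr_le1.
have := sqr_ge0 t; rewrite ler_norml => ?; apply/andP; split; lra.
Qed.

End ExactRotation.

(** By [diagonal_gap] the two pivot diagonal entries are at least half the spectral
gap apart. *)
Lemma jacobi_s_le (R : realType) n (A : 'M[R]_n) (p q : 'I_n) :
  (2 <= n)%N -> A^T = A -> p != q ->
  0 < spectral_gap A -> frob (off A) <= spectral_gap A / 4 ->
  `|jacobi_s A p q| <= 2 * `|A p q| / spectral_gap A.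
Proof.
move=> n2 symA pq d0 offd.
have gap := diagonal_gap n2 symA pq; have sg := jacobi_s_gap A p q.
(* Half the gap is left after twice the off-diagonal norm is removed. *)
rewrite ler_pdivlMr //.
have h : spectral_gap A / 2 <= `|A p p - A q q| by lra.
have := ler_wpM2l (normr_ge0 (jacobi_s A p q)) h; lra.
Qed.

(** * Norms and rotations relative to a pivot pair *)

Lemma sum_split_pair (V : nmodType) (I : finType) (p q : I) (f : I -> V) :
  p != q -> \sum_i f i = f p + f q + \sum_(i | (i != p) && (i != q)) f i.
Proof. by move=> pq; rewrite (bigD1 p) //= (bigD1 q) ?addrA // eq_sym. Qed.

(** All Frobenius norms below are read off this partition of the index pairs: outside
the rows and columns [p], [q]; exactly one index in [{p, q}]; both in it. *)
Lemma sum2_split_pair (V : comNzRingType) (I : finType) (p q : I) (f : I -> I -> V) :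
  p != q ->
  \sum_i \sum_j f i j =
    \sum_(i | (i != p) && (i != q)) \sum_(j | (j != p) && (j != q)) f i j
    + \sum_(j | (j != p) && (j != q)) (f p j + f q j + (f j p + f j q))
    + (f p p + f p q + (f q p + f q q)).
Proof.
move=> pq; have rowE i := sum_split_pair (f i) pq.
rewrite (eq_bigr _ (fun i _ => rowE i)) (sum_split_pair _ pq).
rewrite !big_split /=.
by ring.
Qed.

Section PairSplit.
Variables (R : realType) (n : nat) (p q : 'I_n).
Hypothesis pq : p != q.
Implicit Types X : 'M[R]_n.

Let outer X := \sum_(i | (i != p) && (i != q)) \sum_(j | (j != p) && (j != q)) X i j ^+ 2.

Lemma sqr_frob_Gpart X : X^T = X ->
  frob (Gpart X p q) ^+ 2 = X p p ^+ 2 + 2 * X p q ^+ 2 + X q q ^+ 2.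
Proof.
move=> symX; rewrite frobE (sum2_split_pair _ pq) big1 ?big1 ?add0r.
- rewrite !mxE !inE !eqxx /= !orbT /= -[in X q p]symX mxE; ring.
- move=> j /andP[/negPf jp /negPf jq].
  by rewrite !mxE !inE !eqxx jp jq !orbT !andbF expr0n !addr0.
- move=> i /andP[/negPf ip /negPf iq]; apply: big1 => j _.
  by rewrite !mxE !inE ip iq expr0n.
Qed.

Lemma sqr_frob_Hpart X : X^T = X ->
  frob (Hpart X p q) ^+ 2
    = 2 * \sum_(j | (j != p) && (j != q)) (X p j ^+ 2 + X q j ^+ 2).
Proof.
move=> symX; rewrite frobE (sum2_split_pair _ pq) big1 ?add0r.
- rewrite !mxE !inE !eqxx /= !orbT /= expr0n !addr0 mulr_sumr.
  apply: eq_bigr => j /andP[/negPf jp /negPf jq].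
  rewrite !mxE !inE !eqxx jp jq !orbT /= -[in X j p]symX -[in X j q]symX !mxE; ring.
- move=> i /andP[/negPf ip /negPf iq]; apply: big1 => j /andP[/negPf jp /negPf jq].
  by rewrite !mxE !inE ip iq jp jq expr0n.
Qed.

Lemma sqr_frob_pair X : X^T = X ->
  (forall i j, i != p -> i != q -> j != p -> j != q -> X i j = 0) ->
  frob X ^+ 2 = frob (Hpart X p q) ^+ 2 + frob (Gpart X p q) ^+ 2.
Proof.
move=> symX out; rewrite sqr_frob_Hpart // sqr_frob_Gpart //.
rewrite frobE (sum2_split_pair _ pq) big1 ?add0r.
- rewrite -[in X q p]symX !mxE mulr_sumr; congr (_ + _); last by ring.
  by apply: eq_bigr => j _; rewrite -[in X j p]symX -[in X j q]symX !mxE; ring.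
- by move=> i /andP[ip iq]; apply: big1 => j /andP[jp jq]; rewrite out ?expr0n.
Qed.

Lemma offE X i j : off X i j = if i == j then 0 else X i j.
Proof.
rewrite !mxE; case: eqP => [->|_]; first by rewrite mulr1n subrr.
by rewrite mulr0n subr0.
Qed.

Lemma sqr_frob_off X : X^T = X ->
  frob (off X) ^+ 2 = outer (off X) + frob (Hpart X p q) ^+ 2 + 2 * X p q ^+ 2.
Proof.
move=> symX; rewrite sqr_frob_Hpart // frobE (sum2_split_pair _ pq) -/(outer _).
rewrite !offE !eqxx (negPf pq) eq_sym (negPf pq) expr0n add0r addr0.
congr (_ + _ + _); last by rewrite -[in X q p]symX mxE; ring.
rewrite mulr_sumr; apply: eq_bigr => j /andP[jp jq].
rewrite !offE (negPf jp) (negPf jq) ![_ == j]eq_sym (negPf jp) (negPf jq).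
by rewrite -[in X j p]symX -[in X j q]symX !mxE; ring.
Qed.

(** A rotation only redistributes mass between the pivot entry and the rows and
columns through it. *)
Lemma sqr_frob_off_update X Y : X^T = X -> Y^T = Y ->
  (forall i j, i != p -> i != q -> j != p -> j != q -> Y i j = X i j) ->
  frob (off Y) ^+ 2 - frob (off X) ^+ 2
    = (frob (Hpart Y p q) ^+ 2 - frob (Hpart X p q) ^+ 2)
      + 2 * Y p q ^+ 2 - 2 * X p q ^+ 2.
Proof.
move=> symX symY XY; rewrite !sqr_frob_off //.
have -> : outer (off Y) = outer (off X).
  apply: eq_bigr => i /andP[ip iq]; apply: eq_bigr => j /andP[jp jq].
  by rewrite !offE XY.
by ring.
Qed.

Definition rotmx (c s : R) : 'M[R]_n := \matrix_(i, j)
  if j == p then c * (i == p)%:R - s * (i == q)%:R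
  else if j == q then s * (i == p)%:R + c * (i == q)%:R
  else (i == j)%:R.

Lemma mul_rotmx m (X : 'M[R]_(m, n)) c s i j :
  (X *m rotmx c s) i j =
    if j == p then c * X i p - s * X i q
    else if j == q then s * X i p + c * X i q else X i j.
Proof.
rewrite mxE (sum_split_pair _ pq) !mxE !eqxx (negPf pq) [q == p]eq_sym (negPf pq) /=.
rewrite (eq_bigr (fun k => if (j == p) || (j == q) then 0 else X i k * (k == j)%:R)).
  have [jp|jp] := eqVneq j p; first by rewrite big1 //=; ring.
  have [jq|jq] := eqVneq j q; first by rewrite big1 //=; ring.
  rewrite /= (bigD1 j) ?jp //= eqxx big1 => [|k /andP[_ /negPf ->]]; last by rewrite mulr0.
  by rewrite /=; ring.
move=> k /andP[/negPf kp /negPf kq]; rewrite mxE kp kq.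
by case: eqP => _ /=; [|case: eqP => _ /=]; rewrite ?mulr0 ?addr0 ?subr0 ?mulr0.
Qed.

Lemma mul_trrotmx m (X : 'M[R]_(n, m)) c s i j :
  ((rotmx c s)^T *m X) i j =
    if i == p then c * X p j - s * X q j
    else if i == q then s * X p j + c * X q j else X i j.
Proof.
have -> : (rotmx c s)^T *m X = (X^T *m rotmx c s)^T by rewrite trmx_mul trmxK.
by rewrite mxE mul_rotmx !mxE.
Qed.

Lemma rotmx_orthogonal c s : c ^+ 2 + s ^+ 2 = 1 ->
  (rotmx c s)^T *m rotmx c s = 1%:M.
Proof.
move=> cs; apply/matrixP=> i j; rewrite mul_trrotmx.
rewrite !mxE !eqxx (negPf pq) [q == p]eq_sym (negPf pq).
have [->|ip] := eqVneq i p.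
  have [_|jp] := eqVneq p j; first by rewrite /= -[RHS]cs; ring.
  by have [jq|jq] := eqVneq j q; rewrite /=; ring.
have [->|iq] := eqVneq i q.
  have [jp|jp] := eqVneq j p; first by rewrite jp [q == p]eq_sym (negPf pq) /=; ring.
  have [_|jq] := eqVneq j q; first by rewrite /= -[RHS]cs; ring.
  by rewrite /=; ring.
have [->|jp] := eqVneq j p; first by rewrite (negPf ip) /=; ring.
by have [->|jq] := eqVneq j q; rewrite ?(negPf iq) /=; ring.
Qed.

End PairSplit.

(** * One inexact rotation *)

Section RotationError.
Variable R : realType.
Implicit Types c s a b d x y f g k mu nu r : R.

Lemma sqr_norm_le x r : `|x| <= r -> x ^+ 2 <= r ^+ 2.
Proof.
by move=> xr; rewrite -real_normK ?num_real // lerXn2r // nnegrE // (le_trans _ xr).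
Qed.

(** The triangle inequality in the plane, for squared norms. *)
Lemma perturbed_sqr_norm x y f g k r : 0 <= k -> 0 <= r ->
  x ^+ 2 + y ^+ 2 = r -> f ^+ 2 + g ^+ 2 <= k ^+ 2 * r ->
  (x + f) ^+ 2 + (y + g) ^+ 2 <= (1 + k) ^+ 2 * r.
Proof.
move=> k0 r0 xyr fg.
have cross : x * f + y * g <= k * r.
  rewrite (le_trans (ler_norm _)) // -(ler_pXn2r (n := 2)) ?nnegrE ?mulr_ge0 //.
  rewrite real_normK ?num_real //.
  have -> : (k * r) ^+ 2 = r * (k ^+ 2 * r) by ring.
  apply: le_trans (ler_wpM2l r0 fg); rewrite -xyr.
  by have := sqr_ge0 (x * g - y * f); nra.
by nra.
Qed.

Lemma rotated_abs_le c s x y : c ^+ 2 + s ^+ 2 = 1 ->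
  (`|c| * `|x| + `|s| * `|y|) ^+ 2 <= x ^+ 2 + y ^+ 2.
Proof.
move=> cs; rewrite -[leRHS]mul1r -cs.
rewrite -(real_normK (num_real c)) -(real_normK (num_real s)).
rewrite -(real_normK (num_real x)) -(real_normK (num_real y)).
by have := sqr_ge0 (`|c| * `|y| - `|s| * `|x|); nra.
Qed.

Lemma rotated_error c s x y x' y' mu : c ^+ 2 + s ^+ 2 = 1 ->
  `|x' - (c * x - s * y)| <= mu * (`|c| * `|x| + `|s| * `|y|) ->
  `|y' - (s * x + c * y)| <= mu * (`|s| * `|x| + `|c| * `|y|) ->
  (x' - (c * x - s * y)) ^+ 2 + (y' - (s * x + c * y)) ^+ 2
    <= 2 * mu ^+ 2 * (x ^+ 2 + y ^+ 2).
Proof.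
move=> cs /sqr_norm_le hx /sqr_norm_le hy.
have h1 := rotated_abs_le x y cs.
have h2 : (`|s| * `|x| + `|c| * `|y|) ^+ 2 <= x ^+ 2 + y ^+ 2.
  by apply: rotated_abs_le; rewrite addrC.
rewrite !exprMn in hx hy.
have := ler_wpM2l (sqr_ge0 mu) h1; have := ler_wpM2l (sqr_ge0 mu) h2; lra.
Qed.

Lemma rotated_growth c s x y x' y' mu k : c ^+ 2 + s ^+ 2 = 1 ->
  0 <= k -> 2 * mu ^+ 2 <= k ^+ 2 ->
  `|x' - (c * x - s * y)| <= mu * (`|c| * `|x| + `|s| * `|y|) ->
  `|y' - (s * x + c * y)| <= mu * (`|s| * `|x| + `|c| * `|y|) ->
  x' ^+ 2 + y' ^+ 2 <= (1 + k) ^+ 2 * (x ^+ 2 + y ^+ 2).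
Proof.
move=> cs k0 muk hx hy; have r0 : 0 <= x ^+ 2 + y ^+ 2 by rewrite addr_ge0 ?sqr_ge0.
have -> : x' = (c * x - s * y) + (x' - (c * x - s * y)) by rewrite addrC subrK.
have -> : y' = (s * x + c * y) + (y' - (s * x + c * y)) by rewrite addrC subrK.
apply: perturbed_sqr_norm => //; first by rewrite -[RHS]mul1r -cs; ring.
by apply: le_trans (rotated_error cs hx hy) _; rewrite ler_wpM2r.
Qed.

(** Since [`|c s| <= 1/2], the left side is at most the square of
[(`|a| + `|d|) / 2 + `|b|], and Cauchy-Schwarz applies with weights
[1/4 + 1/4 + 1/2 = 1]. *)
Lemma block_offdiag_le c s a b d : c ^+ 2 + s ^+ 2 = 1 ->
  (`|s| * (`|c| * `|a| + `|s| * `|b|) + `|c| * (`|c| * `|b| + `|s| * `|d|)) ^+ 2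
    <= a ^+ 2 + 2 * b ^+ 2 + d ^+ 2.
Proof.
rewrite -(real_normK (num_real c)) -(real_normK (num_real s)).
rewrite -(real_normK (num_real a)) -(real_normK (num_real b)) -(real_normK (num_real d)).
move: (normr_ge0 c) (normr_ge0 s) (normr_ge0 a) (normr_ge0 b) (normr_ge0 d).
move: `|c| `|s| `|a| `|b| `|d| => {}c {}s {}a {}b {}d c0 s0 a0 b0 d0 cs.
have cs2 : s * c <= 1 / 2 by have := sqr_ge0 (c - s); nra.
have -> : s * (c * a + s * b) + c * (c * b + s * d) = s * c * (a + d) + b.
  by rewrite -[b in RHS]mul1r -cs; ring.
have h1 : s * c * (a + d) + b <= (a + d) / 2 + b.
  by have := ler_wpM2r (addr_ge0 a0 d0) cs2; lra.
have h0 : 0 <= s * c * (a + d) + b by rewrite addr_ge0 ?mulr_ge0 ?addr_ge0.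
apply: le_trans (_ : ((a + d) / 2 + b) ^+ 2 <= _).
  by rewrite ler_sqr // nnegrE (le_trans h0).
rewrite -subr_ge0 (_ : _ - _ = (a - d) ^+ 2 / 2 + ((a + d) / 2 - b) ^+ 2); last by field.
by rewrite addr_ge0 ?divr_ge0 ?sqr_ge0.
Qed.

(** Cauchy-Schwarz with the weights [c^4 + 2 c^2 s^2 + s^4 = 1]. *)
Lemma block_diag_le c s a b d : c ^+ 2 + s ^+ 2 = 1 ->
  (`|c| * (`|c| * `|a| + `|s| * `|b|) + `|s| * (`|c| * `|b| + `|s| * `|d|)) ^+ 2
    <= a ^+ 2 + 2 * b ^+ 2 + d ^+ 2.
Proof.
rewrite -(real_normK (num_real c)) -(real_normK (num_real s)).
rewrite -(real_normK (num_real a)) -(real_normK (num_real b)) -(real_normK (num_real d)).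
move: `|c| `|s| `|a| `|b| `|d| => {}c {}s {}a {}b {}d cs.
have -> : a ^+ 2 + 2 * b ^+ 2 + d ^+ 2
    = (c ^+ 2 + s ^+ 2) ^+ 2 * (a ^+ 2 + 2 * b ^+ 2 + d ^+ 2).
  by rewrite cs expr1n mul1r.
rewrite -subr_ge0.
rewrite (_ : _ - _ = 2 * (c ^+ 2 * b - c * s * a) ^+ 2 + (c ^+ 2 * d - s ^+ 2 * a) ^+ 2
   + 2 * (c * s * d - s ^+ 2 * b) ^+ 2); last by ring.
have nn (x : R) : 0 <= 2 * x ^+ 2 by rewrite mulr_ge0 ?sqr_ge0.
by rewrite !addr_ge0 ?sqr_ge0 ?nn.
Qed.

End RotationError.

Section NearRotation.
Variables (R : realType) (n : nat) (A B : 'M[R]_n) (p q : 'I_n) (c s mu nu : R).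
Hypotheses (pq : p != q) (symA : A^T = A) (cs : c ^+ 2 + s ^+ 2 = 1).
Hypothesis annih : s * (c * A p p - s * A p q) + c * (c * A p q - s * A q q) = 0.
Hypothesis AB : near_rotation A p q c s mu nu B.

Let symB : B^T = B. Proof. by case: AB. Qed.
Let J := rotmx p q c s.

(** The exact rotation preserves the norm of each pair of entries in rows [p], [q],
so only the rounding error contributes to the growth. *)
Lemma near_rotation_Hpart k : 0 <= k -> 2 * mu ^+ 2 <= k ^+ 2 ->
  frob (Hpart B p q) ^+ 2 <= (1 + k) ^+ 2 * frob (Hpart A p q) ^+ 2.
Proof.
move=> k0 muk; have [_ _ rows _] := AB.
rewrite !sqr_frob_Hpart // mulrCA ler_wpM2l // mulr_sumr; apply: ler_sum => j /andP[jp jq].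
by have [hp hq] := rows j jp jq; apply: rotated_growth hp hq.
Qed.

(** The exact rotated pivot vanishes, so the computed one is pure rounding error. *)
Lemma near_rotation_pivot :
  B p q ^+ 2 <= nu ^+ 2 * frob (Gpart A p q) ^+ 2.
Proof.
have [_ _ _ [_ hpq _]] := AB; rewrite annih subr0 in hpq.
have := sqr_norm_le hpq; rewrite exprMn sqr_frob_Gpart // => /le_trans; apply.
by rewrite ler_wpM2l ?sqr_ge0 ?block_offdiag_le.
Qed.

Lemma near_rotation_error :
  frob (B - J^T *m A *m J) ^+ 2
    <= 2 * mu ^+ 2 * frob (Hpart A p q) ^+ 2 + 4 * nu ^+ 2 * frob (Gpart A p q) ^+ 2.
Proof.
have [_ out rows [hpp hpq hqq]] := AB.
have Aqp : A q p = A p q by rewrite -[in LHS]symA mxE.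
set E := B - _.
have EE i j : E i j = B i j - (J^T *m A *m J) i j by rewrite !mxE.
have symE : E^T = E.
  by rewrite /E linearB /= symB !trmx_mul trmxK symA mulmxA.
rewrite (sqr_frob_pair pq symE); last first.
  move=> i j ip iq jp jq; rewrite EE mul_rotmx // (negPf jp) (negPf jq).
  by rewrite mul_trrotmx // (negPf ip) (negPf iq) out // subrr.
have qp : (q == p) = false by rewrite eq_sym (negPf pq).
apply: lerD.
  rewrite !sqr_frob_Hpart // mulrCA ler_wpM2l // mulr_sumr.
  apply: ler_sum => j /andP[jp jq].
  have [hp hq] := rows j jp jq.
  rewrite !EE !mul_rotmx // (negPf jp) (negPf jq) !mul_trrotmx // !eqxx qp.
  exact: rotated_error hp hq.
rewrite !sqr_frob_Gpart // !EE !mul_rotmx // !eqxx qp !mul_trrotmx // !eqxx qp Aqp.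
set g := A p p ^+ 2 + _ + _.
have g1 : (B p p - (c * (c * A p p - s * A p q) - s * (c * A p q - s * A q q))) ^+ 2
    <= nu ^+ 2 * g.
  have := sqr_norm_le hpp; rewrite exprMn => /le_trans; apply.
  by rewrite ler_wpM2l ?sqr_ge0 ?block_diag_le.
have g2 : (B q q - (s * (s * A p p + c * A p q) + c * (s * A p q + c * A q q))) ^+ 2
    <= nu ^+ 2 * g.
  have := sqr_norm_le hqq; rewrite exprMn => /le_trans; apply.
  by rewrite ler_wpM2l ?sqr_ge0 // block_diag_le // addrC.
have g3 := near_rotation_pivot; rewrite sqr_frob_Gpart // -/g in g3.
rewrite (_ : s * (c * A p p - s * A p q) + _ = 0) // subr0.
lra.
Qed.

Lemma near_rotation_off :
  frob (off B) ^+ 2 = frob (off A) ^+ 2 - 2 * A p q ^+ 2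
    + (frob (Hpart B p q) ^+ 2 - frob (Hpart A p q) ^+ 2) + 2 * B p q ^+ 2.
Proof.
have [_ out _ _] := AB.
by have := sqr_frob_off_update pq symA symB out; lra.
Qed.
End NearRotation.

Section Frobenius.
Variables (R : realType) (m n : nat).
Implicit Types X Y : 'M[R]_(m, n).

Lemma le_frob X Y : (forall i j, `|X i j| <= Y i j) -> frob X <= frob Y.
Proof.
move=> XY; rewrite ler_wsqrtr //; apply: ler_sum => i _; apply: ler_sum => j _.
exact: sqr_norm_le.
Qed.

Lemma frobZ a X : 0 <= a -> frob (a *: X) = a * frob X.
Proof.
move=> a0; rewrite /frob -[a in RHS]ger0_norm // -sqrtr_sqr -sqrtrM ?sqr_ge0 //.
congr Num.sqrt; rewrite mulr_sumr; apply: eq_bigr => i _.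
by rewrite mulr_sumr; apply: eq_bigr => j _; rewrite mxE exprMn.
Qed.

Lemma frobD X Y : frob (X + Y) <= frob X + frob Y.
Proof.
rewrite -(ler_pXn2r (n := 2)) ?nnegrE ?addr_ge0 ?frob_ge0 // sqrrD !frobE.
rewrite (_ : \sum_i \sum_j (X + Y) i j ^+ 2 = \sum_i \sum_j X i j ^+ 2
   + 2 * (\sum_i \sum_j X i j * Y i j) + \sum_i \sum_j Y i j ^+ 2); last first.
  rewrite mulr_sumr -!big_split /=; apply: eq_bigr => i _.
  rewrite mulr_sumr -!big_split /=; apply: eq_bigr => j _.
  by rewrite mxE; ring.
rewrite lerD2r lerD2l mulr_natl lerMn2r /= (le_trans (ler_norm _)) //.
rewrite -(ler_pXn2r (n := 2)) ?nnegrE ?mulr_ge0 ?frob_ge0 //.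
rewrite real_normK ?num_real // exprMn !frobE !pair_big /=.
exact: cauchy_schwarz_sum.
Qed.

Lemma frob_sum (I : Type) (r : seq I) (X : I -> 'M[R]_(m, n)) :
  frob (\sum_(k <- r) X k) <= \sum_(k <- r) frob (X k).
Proof.
elim/big_rec2: _ => [|k x Y _ le_Yx].
  rewrite /frob big1 ?sqrtr0 // => i _; apply: big1 => j _.
  by rewrite mxE expr0n.
by rewrite (le_trans (frobD _ _)) // lerD2l.
Qed.

End Frobenius.

Lemma frob_perm (R : realType) n (s : 'S_n) (X : 'M[R]_n) :
  frob (\matrix_(i, j) `|X (s i) (s j)|) = frob X.
Proof.
congr Num.sqrt; rewrite [RHS](reindex_inj (@perm_inj _ s)) /=.
apply: eq_bigr => i _; rewrite [RHS](reindex_inj (@perm_inj _ s)) /=.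
by apply: eq_bigr => j _; rewrite mxE real_normK ?num_real.
Qed.

(** * Growth of annihilated entries during a sweep *)

Definition is_pivot n (p q i j : 'I_n) : bool :=
  ((i == p) && (j == q)) || ((i == q) && (j == p)).

Definition shares_one n (p q i j : 'I_n) : bool :=
  (i \in [:: p; q]) (+) (j \in [:: p; q]).

(** The entry with which [(i, j)] is mixed by the rotation, and zero where nothing
is mixed: exchanging [p] and [q] in the indices yields it, so that this matrix
has the norm of [Hpart A p q]. *)
Definition partner (R : realType) n (A : 'M[R]_n) (p q : 'I_n) : 'M[R]_n :=
  \matrix_(i, j) `|Hpart A p q (tperm p q i) (tperm p q j)|.

Lemma frob_partner (R : realType) n (A : 'M[R]_n) (p q : 'I_n) :
  frob (partner A p q) = frob (Hpart A p q).
Proof. exact: frob_perm. Qed.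

(** As [`|c| <= 1], an entry gains at most [`|s|] times its partner, and pays a
factor [1 + g] for rounding only when the rotation touches it. *)
Lemma near_rotation_entry (R : realType) n (A B : 'M[R]_n) (p q : 'I_n)
    (c s mu nu g : R) (i j : 'I_n) :
  p != q -> A^T = A -> c ^+ 2 + s ^+ 2 = 1 -> 0 <= mu -> mu <= g ->
  near_rotation A p q c s mu nu B ->
  i != j -> ~~ is_pivot p q i j ->
  `|B i j| <= (1 + g) ^+ shares_one p q i j * (`|A i j| + `|s| * partner A p q i j).
Proof.
move=> pq symA cs mu0 mug [symB out rows _] ij.
have c1 := abs_cos_le1 cs.
have Aji k l : A k l = A l k by rewrite -[in LHS]symA mxE.
have Bji k l : B k l = B l k by rewrite -[in LHS]symB mxE.
have bound b e x y : `|b - e| <= mu * (`|c| * x + `|s| * y) ->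
    `|e| <= `|c| * x + `|s| * y -> 0 <= x -> 0 <= y -> `|b| <= (1 + g) * (x + `|s| * y).
  move=> h1 h2 x0 y0; have s0 := normr_ge0 s; have c0 := normr_ge0 c.
  have cx : `|c| * x <= x by rewrite ler_piMl.
  have sy : 0 <= `|s| * y by rewrite mulr_ge0.
  have hb : `|b| <= `|b - e| + `|e| by rewrite -{1}(subrK e b) ler_normD.
  have hm : mu * (`|c| * x + `|s| * y) <= g * (x + `|s| * y).
    by rewrite ler_pM ?addr_ge0 ?mulr_ge0 ?lerD2r.
  by lra.
have rowp k : k != p -> k != q -> `|B p k| <= (1 + g) * (`|A p k| + `|s| * `|A q k|).
  move=> kp kq; have [hp _] := rows k kp kq; apply: bound hp _ _ _ => //.
  by rewrite (le_trans (ler_normB _ _)) // !normrM.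
have rowq k : k != p -> k != q -> `|B q k| <= (1 + g) * (`|A q k| + `|s| * `|A p k|).
  move=> kp kq; have [_ hq] := rows k kp kq.
  rewrite [s * _ + _]addrC [`|s| * _ + _]addrC in hq; apply: bound hq _ _ _ => //.
  by rewrite (le_trans (ler_normD _ _)) // !normrM.
rewrite /is_pivot /shares_one mxE mxE !inE.
have qp : (q == p) = false by rewrite eq_sym (negPf pq).
have fix_out k : k != p -> k != q -> tperm p q k = k.
  by move=> kp kq; rewrite tpermD // eq_sym.
have [ip|ip] := eqVneq i p.
  rewrite ip eq_sym in ij; rewrite ip (negPf pq) tpermL eqxx qp /= orbF.
  move=> jq; rewrite fix_out // (negPf ij) (negPf jq) expr1 /=.
  exact: rowp.
have [iq|iq] := eqVneq i q.
  rewrite iq eq_sym in ij; rewrite iq tpermR eqxx /=.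
  move=> jp; rewrite fix_out // (negPf jp) (negPf ij) expr1 /=.
  exact: rowq.
rewrite fix_out // (negPf ip) (negPf iq) /= => _.
have [jp|jp] := eqVneq j p.
  by rewrite jp tpermL eqxx orbT expr1 Bji [A i p]Aji [A i q]Aji; exact: rowp.
have [jq|jq] := eqVneq j q.
  by rewrite jq tpermR eqxx expr1 Bji [A i p]Aji [A i q]Aji; exact: rowq.
by rewrite fix_out // (negPf jp) (negPf jq) out //= normr0 mulr0 addr0 mul1r.
Qed.

Section Accumulation.
Variables (R : realType) (n N : nat) (A : nat -> 'M[R]_n) (p q : nat -> 'I_n).
Variables (b : R) (W : nat -> 'M[R]_n) (r : 'M[R]_n).
Hypothesis b_ge1 : 1 <= b.
Hypothesis r_ge0 : forall i j, 0 <= r i j.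
Hypothesis W_ge0 : forall k i j, 0 <= W k i j.
Hypothesis pivot_le : forall (k : nat) i j, (k < N)%N ->
  is_pivot (p k) (q k) i j -> `|A k.+1 i j| <= r i j.
Hypothesis entry_le : forall (k : nat) i j, (k < N)%N -> i != j ->
  ~~ is_pivot (p k) (q k) i j ->
  `|A k.+1 i j| <= b ^+ shares_one (p k) (q k) i j * (`|A k i j| + W k i j).

(** Annihilation resets an entry to its residual [r i j]; every later step adds at
most [W l i j] and multiplies by [b] only if it touches the entry. *)
Lemma entry_after_pivot (m : nat) i j : (m <= N)%N -> i != j ->
  (exists2 l, (l < m)%N & is_pivot (p l) (q l) i j) ->
  `|A m i j| <= b ^+ (\sum_(l < m) shares_one (p l) (q l) i j)%N
                * (r i j + \sum_(l < m) W l i j).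
Proof.
elim: m => [_ _ []//|m IH mN ij [l lm pl]].
set e := (\sum_(l < m.+1) _)%N; set w := \sum_(l < m.+1) W l i j.
have w0 : 0 <= w by apply: sumr_ge0 => k _; exact: W_ge0.
have [piv|npiv] := boolP (is_pivot (p m) (q m) i j).
  rewrite (le_trans (pivot_le mN piv)) // -[leLHS]mul1r ler_pM //.
    by rewrite exprn_ege1.
  by rewrite lerDl.
have lm' : (l < m)%N.
  by rewrite ltn_neqAle -ltnS lm andbT; apply: contra npiv => /eqP <-.
rewrite (le_trans (entry_le mN ij npiv)) // /e big_ord_recr /= addnC exprD -mulrA.
rewrite ler_wpM2l ?exprn_ge0 ?(le_trans ler01) // /w big_ord_recr /= addrA mulrDr.
apply: lerD; first by apply: IH => //; [exact: ltnW | exists l].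
by rewrite ler_peMl ?exprn_ege1.
Qed.

End Accumulation.

Lemma shares_one_sym n (p q i j : 'I_n) : p != q -> i != j ->
  shares_one p q i j = (p \in [set i; j]) (+) (q \in [set i; j]).
Proof.
move=> pq ij; rewrite /shares_one !inE ![i == _]eq_sym ![j == _]eq_sym.
have h1 : ~~ ((p == i) && (q == i)).
  by apply: contra pq => /andP[/eqP -> /eqP ->].
have h2 : ~~ ((p == j) && (q == j)).
  by apply: contra pq => /andP[/eqP -> /eqP ->].
have h3 : ~~ ((p == i) && (p == j)).
  by apply: contra ij => /andP[/eqP <- /eqP <-].
have h4 : ~~ ((q == i) && (q == j)).
  by apply: contra ij => /andP[/eqP <- /eqP <-].
by move: h1 h2 h3 h4; do 4!case: (_ == _).
Qed.

Section Sweep.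
Variables (n : nat) (p q : nat -> 'I_n).
Hypothesis cyc : general_cyclic_order p q.
Local Notation N := (npairs n).

Lemma sweep_pair_inj (k l : 'I_N) : p k = p l -> q k = q l -> k = l.
Proof.
move=> pkl qkl; have [plt ex1] := cyc.
have [m [_ um]] := ex1 0%N (p k) (q k) (plt k).
by rewrite -(um k) // -(um l).
Qed.

Lemma sweep_pivot (i j : 'I_n) : i != j ->
  exists2 k, (k < N)%N & is_pivot (p k) (q k) i j.
Proof.
have [_ ex1] := cyc; rewrite -val_eqE neq_ltn => /orP[ij|ij].
  by have [k [[<- <-] _]] := ex1 0%N _ _ ij; exists k; rewrite // /is_pivot !eqxx.
by have [k [[<- <-] _]] := ex1 0%N _ _ ij; exists k; rewrite // /is_pivot !eqxx orbT.
Qed.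

(** A pair sharing exactly one index with [{i, j}] is determined by that index and
by its other element, which leaves [2 (n - 2)] possibilities; the steps of the
sweep use different pairs. *)
Lemma sweep_shares_one (i j : 'I_n) : i != j ->
  (\sum_(k < N) shares_one (p k) (q k) i j <= 2 * n - 4)%N.
Proof.
move=> ij; have [plt _] := cyc.
pose K := [set k : 'I_N | shares_one (p k) (q k) i j].
have -> : (\sum_(k < N) shares_one (p k) (q k) i j = #|K|)%N.
  rewrite -sum1_card [RHS]big_mkcond; apply: eq_bigr => k _.
  by rewrite inE; case: shares_one.
(* The shared index comes first. *)
pose f (k : 'I_N) := if p k \in [set i; j] then (p k, q k) else (q k, p k).
have shE (k : 'I_N) : shares_one (p k) (q k) i j =
    (p k \in [set i; j]) (+) (q k \in [set i; j]).
  apply: shares_one_sym => //; by rewrite -val_eqE neq_ltn plt.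
have f_inj : {in K &, injective f}.
  move=> k l; rewrite !inE !shE /f => hk hl.
  case: ifP hk => pk; case: ifP hl => pl /= ql qk [e1 e2].
  - exact: sweep_pair_inj.
  - by move: (plt k) (plt l); rewrite e1 e2 => h1 h2; have := ltn_trans h1 h2; rewrite ltnn.
  - by move: (plt k) (plt l); rewrite e1 e2 => h1 h2; have := ltn_trans h1 h2; rewrite ltnn.
  - exact: sweep_pair_inj.
rewrite -(card_in_imset f_inj).
have sub : f @: K \subset setX [set i; j] (~: [set i; j]).
  apply/subsetP=> _ /imsetP[k kK ->]; move: kK; rewrite inE shE /f.
  by case: ifP => pk /= qk; rewrite in_setX in_setC /= pk ?qk // andbT.
apply: leq_trans (subset_leq_card sub) _.
by rewrite cardsX (cardsCs (~: _)) setCK cards2 ij card_ord mulnBr.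
Qed.
End Sweep.

(** * One floating point Jacobi step *)

(** The pivot occupies two symmetric positions. *)
Lemma sum_pivot (R : realType) n (p q : 'I_n) (X : 'M[R]_n) : p != q -> X^T = X ->
  \sum_i \sum_j (if is_pivot p q i j then X i j ^+ 2 else 0) = 2 * X p q ^+ 2.
Proof.
move=> pq symX; have qp : (q == p) = false by rewrite eq_sym (negPf pq).
rewrite (sum2_split_pair _ pq) /is_pivot !eqxx (negPf pq) qp /= big1 => [|i]; last first.
  by case/andP=> /negPf -> /negPf ->; rewrite big1.
rewrite big1 => [|j /andP[/negPf -> /negPf ->]]; last by rewrite !andbF !addr0.
by rewrite -[in X q p]symX mxE; ring.
Qed.

Section OneStep.
Variables (R : realType) (w : nat) (u : R) (n : nat) (A B : 'M[R]_n) (p q : 'I_n).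
Hypotheses (u_gt0 : 0 < u) (u_lt1 : u < 1) (w_ge6 : (6 <= w)%N).
Hypotheses (n_ge2 : (2 <= n)%N) (pq : p != q) (symA : A^T = A).
Hypothesis step : fl_jacobi_step w u A p q B.

Lemma gammat_ge0 j : 0 <= gammat w u j.
Proof. by rewrite gammatE subr_ge0 exprn_ege1 // amp_ge1. Qed.

Lemma sqr_one_gammat2 : (1 + gammat w u 2) ^+ 2 = 1 + gammat w u 4.
Proof. by rewrite !gammatE ![1 + _]addrC !subrK -exprM -mulnA. Qed.

Let g4 := gammat w u 4.
Let G := frob (Gpart A p q).
Let H := frob (Hpart A p q).
Let phi := varphi A p q.

Let near := fl_jacobi_step_near_rotation u_gt0 u_lt1 w_ge6 step.
Let g2_ge0 := gammat_ge0 2.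
Let g4_ge0 : 0 <= g4 := gammat_ge0 4.

Lemma fl_jacobi_step_sym : B^T = B.
Proof. by case: near. Qed.

Lemma fl_jacobi_step_pivot : 2 * B p q ^+ 2 <= G ^+ 2 * g4 ^+ 2.
Proof.
have := near_rotation_pivot pq symA (jacobi_sqr A p q) (jacobi_annihilates A p q) near.
rewrite -/G -/g4 => h.
have : 0 <= G ^+ 2 * g4 ^+ 2 by rewrite mulr_ge0 ?sqr_ge0.
by rewrite exprMn in h; lra.
Qed.

(** The annihilated pivot removes [2 a_pq^2]; the rows [p], [q] grow by a factor at
most [(1 + gamma_2)^2 = 1 + gamma_4], and the new pivot adds at most
[G^2 gamma_4^2]. *)
Lemma fl_jacobi_step_off :
  frob (off B) ^+ 2 <= frob (off A) ^+ 2 - 2 * A p q ^+ 2 + H ^+ 2 * g4 + G ^+ 2 * g4 ^+ 2.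
Proof.
have hoff := near_rotation_off pq symA near.
have hpiv := fl_jacobi_step_pivot.
have mu2 : 2 * (2 / 3 * gammat w u 2) ^+ 2 <= gammat w u 2 ^+ 2.
  by have := sqr_ge0 (gammat w u 2); rewrite exprMn; lra.
have := near_rotation_Hpart pq symA (jacobi_sqr A p q) near g2_ge0 mu2.
rewrite sqr_one_gammat2 -/g4 => hgrow; rewrite /G /H in hpiv *; lra.
Qed.

(** The computed matrix differs from an orthogonal conjugate of [A] by at most
[phi * g4], since [2 H^2] and [4 G^2] are below the two terms of [phi^2]. *)
Lemma fl_jacobi_step_spectral_gap :
  spectral_gap A - 2 * (phi * g4) <= spectral_gap B.
Proof.
set J := rotmx p q (jacobi_c A p q) (jacobi_s A p q).
have orthJ : J^T *m J = 1%:M by apply: rotmx_orthogonal => //; exact: jacobi_sqr.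
have symJ : (J^T *m A *m J)^T = J^T *m A *m J.
  by rewrite !trmx_mul trmxK symA mulmxA.
rewrite -(spectral_gap_conj A orthJ).
apply: le_trans (spectral_gap_perturb n_ge2 symJ fl_jacobi_step_sym).
rewrite lerD2l lerN2 ler_wpM2l //.
have -> : frob (J^T *m A *m J - B) = frob (B - J^T *m A *m J).
  by rewrite -opprB -scaleN1r; congr Num.sqrt; apply: eq_bigr => i _;
     apply: eq_bigr => j _; rewrite !mxE mulN1r sqrrN.
have err := near_rotation_error pq symA (jacobi_sqr A p q) (jacobi_annihilates A p q) near.
have phi_ge0 : 0 <= phi by exact: sqrtr_ge0.
rewrite -(ler_pXn2r (n := 2)) ?nnegrE ?frob_ge0 ?mulr_ge0 //.
apply: le_trans err _; rewrite -/H -/G -/g4 [leRHS]exprMn.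
have sqrt2 : 0 <= Num.sqrt 2 :> R by exact: sqrtr_ge0.
have -> : phi ^+ 2 = (6 + 4 * Num.sqrt 2) * G ^+ 2 + 2 * H ^+ 2.
  rewrite sqr_sqrtr //; apply: addr_ge0; apply: mulr_ge0; rewrite ?sqr_ge0 //.
  by lra.
have g24 : gammat w u 2 ^+ 2 <= g4 ^+ 2.
  rewrite ler_sqr ?nnegrE // /g4 !gammatE lerD2r ler_weXn2l ?amp_ge1 //.
  by rewrite leq_mul2l orbT.
have hH := ler_wpM2r (sqr_ge0 H) g24.
have hG : 0 <= G ^+ 2 * g4 ^+ 2 by rewrite mulr_ge0 ?sqr_ge0.
have hG2 : 0 <= Num.sqrt 2 * (G ^+ 2 * g4 ^+ 2) by rewrite mulr_ge0.
have hH0 : 0 <= gammat w u 2 ^+ 2 * H ^+ 2 by rewrite mulr_ge0 ?sqr_ge0.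
rewrite !exprMn; lra.
Qed.

(** With [e = phi * g4], the hypothesis on the pivot gives
[off(B)^2 < off(A)^2 - off(A) e], so [e <= off(A)] and
[off(B) <= off(A) - e / 2], which matches the decrease [2 e] of the gap. *)
Lemma off_stays_below_gap :
  frob (off A) < spectral_gap A / 4 ->
  1 / 8 * phi ^+ 2 * g4 ^+ 2 + 1 / 2 * frob (off A) * phi * g4
    + H ^+ 2 * g4 + G ^+ 2 * g4 ^+ 2 < `|A p q| ^+ 2 ->
  frob (off B) < spectral_gap B / 4.
Proof.
move=> offA.
have -> : `|A p q| ^+ 2 = A p q ^+ 2 by rewrite real_normK ?num_real.
move=> small.
have hoff := fl_jacobi_step_off; have hgap := fl_jacobi_step_spectral_gap.
set a := frob (off A) in offA small hoff; set b := frob (off B) in hoff *.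
have a0 : 0 <= a by exact: frob_ge0.
have b0 : 0 <= b by exact: frob_ge0.
have phi_ge0 : 0 <= phi by exact: sqrtr_ge0.
have e0 : 0 <= phi * g4 by rewrite mulr_ge0.
have hH : 0 <= H ^+ 2 * g4 by rewrite mulr_ge0 ?sqr_ge0.
have hG : 0 <= G ^+ 2 * g4 ^+ 2 by rewrite mulr_ge0 ?sqr_ge0.
have e2 : 0 <= (phi * g4) ^+ 2 by exact: sqr_ge0.
have key : b ^+ 2 < a ^+ 2 - a * (phi * g4).
  by rewrite exprMn in e2; lra.
have ea : phi * g4 <= a.
  by rewrite leNgt; apply/negP => ae; nra.
have : b <= a - phi * g4 / 2.
  rewrite -(ler_pXn2r (n := 2)) ?nnegrE //; first by nra.
  by lra.
lra.
Qed.

Lemma fl_jacobi_step_entry i j : i != j -> ~~ is_pivot p q i j ->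
  `|B i j| <= (1 + gammat w u 2) ^+ shares_one p q i j
              * (`|A i j| + `|jacobi_s A p q| * partner A p q i j).
Proof.
apply: near_rotation_entry pq symA (jacobi_sqr A p q) _ _ near.
- by have := g2_ge0; lra.
- by have := g2_ge0; lra.
Qed.

End OneStep.

Lemma sum_le_sqrt (R : rcfType) N (x : 'I_N -> R) :
  \sum_k x k <= Num.sqrt (N%:R * \sum_k x k ^+ 2).
Proof.
have sq0 : 0 <= \sum_k x k ^+ 2 by apply: sumr_ge0 => k _; exact: sqr_ge0.
have := cauchy_schwarz_sum (fun=> 1) x.
rewrite (eq_bigr x) => [|k _]; last by rewrite mul1r.
rewrite [X in X * _](eq_bigr (fun=> 1)) => [|k _]; last by rewrite expr1n.
rewrite sumr_const card_ord => cs; rewrite (le_trans (ler_norm _)) //.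
by rewrite -sqrtr_sqr ler_wsqrtr.
Qed.

(** * A full sweep *)

Section JacobiSweep.
Variables (R : realType) (w : nat) (u : R) (n : nat).
Variables (A : nat -> 'M[R]_n) (p q : nat -> 'I_n).
Hypotheses (u_gt0 : 0 < u) (u_lt1 : u < 1) (w_ge6 : (6 <= w)%N) (n_ge2 : (2 <= n)%N).
Hypothesis symA0 : (A 0%N)^T = A 0%N.
Hypothesis cyc : general_cyclic_order p q.
Hypothesis steps : forall k, fl_jacobi_step w u (A k) (p k) (q k) (A k.+1).

Local Notation N := (npairs n).
Let G k := frob (Gpart (A k) (p k) (q k)).
Let H k := frob (Hpart (A k) (p k) (q k)).
Let g2 := gammat w u 2.
Let g4 := gammat w u 4.
Let s k := jacobi_s (A k) (p k) (q k).

Let g2_ge0 : 0 <= g2. Proof. exact: gammat_ge0. Qed.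
Let g4_ge0 : 0 <= g4. Proof. exact: gammat_ge0. Qed.

Let pq k : p k != q k.
Proof. by have [plt _] := cyc; rewrite -val_eqE neq_ltn plt. Qed.

Let symA k : (A k)^T = A k.
Proof. by case: k => // k; apply: fl_jacobi_step_sym (steps k). Qed.

(** In a sweep each sum has at most one nonzero term, the value left at [(i, j)] by its
annihilation; the quadratic mean makes the Frobenius norm additive over steps. *)
Definition residual : 'M[R]_n := \matrix_(i, j)
  Num.sqrt (\sum_(k < N) if is_pivot (p k) (q k) i j then A k.+1 i j ^+ 2 else 0).

Let pivot_term_ge0 (k : nat) i j :
  0 <= (if is_pivot (p k) (q k) i j then A k.+1 i j ^+ 2 else 0).
Proof. by case: ifP => // _; exact: sqr_ge0. Qed.

Lemma frob_residual : frob residual <= Num.sqrt (\sum_(k < N) G k ^+ 2) * g4.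
Proof.
have sG : 0 <= \sum_(k < N) G k ^+ 2 by apply: sumr_ge0 => k _; exact: sqr_ge0.
rewrite -(ler_pXn2r (n := 2)) ?nnegrE ?mulr_ge0 ?frob_ge0 ?sqrtr_ge0 //.
rewrite frobE exprMn sqr_sqrtr // mulr_suml.
rewrite (eq_bigr (fun i => \sum_(k < N) \sum_j
  if is_pivot (p k) (q k) i j then A k.+1 i j ^+ 2 else 0)); last first.
  move=> i _; rewrite exchange_big /=; apply: eq_bigr => j _.
  by rewrite mxE sqr_sqrtr // sumr_ge0.
rewrite exchange_big /=; apply: ler_sum => k _.
rewrite sum_pivot //.
exact: fl_jacobi_step_pivot u_gt0 u_lt1 w_ge6 (pq k) (symA k) (steps k).
Qed.

Lemma residual_ge i j (k : nat) : (k < N)%N -> is_pivot (p k) (q k) i j ->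
  `|A k.+1 i j| <= residual i j.
Proof.
move=> kN piv; rewrite mxE -sqrtr_sqr ler_wsqrtr //.
rewrite (bigD1 (Ordinal kN)) //= piv lerDl.
by apply: sumr_ge0 => l _.
Qed.

(** [entry_after_pivot] at the end of the sweep, summed in the Frobenius norm: the
partners at step [k] have norm [H k]. *)
Lemma sweep_off_le :
  frob (off (A N)) <= (1 + g2) ^+ (2 * n - 4) * (frob residual + \sum_(k < N) `|s k| * H k).
Proof.
have b1 : 1 <= 1 + g2 by rewrite lerDl.
pose W k := `|s k| *: partner (A k) (p k) (q k).
have W_ge0 k i j : 0 <= W k i j by rewrite !mxE mulr_ge0.
have res_ge0 i j : 0 <= residual i j by rewrite mxE sqrtr_ge0.
have entry (k : nat) i j : (k < N)%N -> i != j -> ~~ is_pivot (p k) (q k) i j ->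
    `|A k.+1 i j| <= (1 + g2) ^+ shares_one (p k) (q k) i j * (`|A k i j| + W k i j).
  move=> _ ij np; rewrite [W k i j]mxE.
  exact: (fl_jacobi_step_entry u_gt0 u_lt1 w_ge6 (pq k) (symA k) (steps k)).
have entries := entry_after_pivot b1 res_ge0 W_ge0
  (fun k i j kN => @residual_ge i j k kN) entry.
apply: le_trans (_ : frob ((1 + g2) ^+ (2 * n - 4) *: (residual + \sum_(k < N) W k)) <= _).
  apply: le_frob => i j; rewrite offE [leRHS]mxE [X in _ * X]mxE summxE.
  have rhs0 : 0 <= residual i j + \sum_(k < N) W k i j.
    by rewrite addr_ge0 // sumr_ge0.
  case: eqVneq => [_|ij].
    by rewrite normr0 mulr_ge0 // exprn_ge0 // (le_trans ler01).
  apply: le_trans (entries N i j (leqnn _) ij (sweep_pivot cyc ij)) _.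
  by rewrite ler_wpM2r // ler_weXn2l // sweep_shares_one.
rewrite frobZ ?exprn_ge0 ?(le_trans ler01) //.
rewrite ler_wpM2l ?exprn_ge0 ?(le_trans ler01) // (le_trans (frobD _ _)) //.
rewrite lerD2l (le_trans (frob_sum _ _)) //; apply: ler_sum => k _.
by rewrite frobZ // frob_partner.
Qed.

(** Telescoping of [fl_jacobi_step_off]. *)
Lemma sum_sqr_pivots m :
  2 * \sum_(k < m) A k (p k) (q k) ^+ 2
    <= frob (off (A 0%N)) ^+ 2 + \sum_(k < m) H k ^+ 2 * g4
       + \sum_(k < m) G k ^+ 2 * g4 ^+ 2.
Proof.
suff : 2 * \sum_(k < m) A k (p k) (q k) ^+ 2 + frob (off (A m)) ^+ 2
    <= frob (off (A 0%N)) ^+ 2 + \sum_(k < m) H k ^+ 2 * g4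
       + \sum_(k < m) G k ^+ 2 * g4 ^+ 2.
  by have := sqr_ge0 (frob (off (A m))); lra.
elim: m => [|m IH]; first by rewrite !big_ord0 mulr0 add0r !addr0.
have hoff := fl_jacobi_step_off u_gt0 u_lt1 w_ge6 (pq m) (symA m) (steps m).
rewrite -/(G m) -/(H m) -/g4 in hoff.
by rewrite !big_ord_recr /= mulrDr; lra.
Qed.

Hypothesis small : forall k : nat, (k < N)%N ->
  1 / 8 * varphi (A k) (p k) (q k) ^+ 2 * g4 ^+ 2
    + 1 / 2 * frob (off (A k)) * varphi (A k) (p k) (q k) * g4
    + H k ^+ 2 * g4 + G k ^+ 2 * g4 ^+ 2 < `|A k (p k) (q k)| ^+ 2.
Hypothesis offA0 : frob (off (A 0%N)) < spectral_gap (A 0%N) / 4.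

Lemma sweep_off_lt_gap k : (k <= N)%N -> frob (off (A k)) < spectral_gap (A k) / 4.
Proof.
elim: k => [_|k IH kN]; first exact: offA0.
exact: (off_stays_below_gap u_gt0 u_lt1 w_ge6 n_ge2 (pq k) (symA k) (steps k)
  (IH (ltnW kN)) (small kN)).
Qed.

Lemma sweep_spectral_gap_gt0 k : (k <= N)%N -> 0 < spectral_gap (A k).
Proof.
by move=> kN; have := sweep_off_lt_gap kN; have := frob_ge0 (off (A k)); lra.
Qed.

Lemma npairs_gt0 : (0 < N)%N.
Proof. by rewrite divn_gt0 // -[2%N]/(2 * 1)%N leq_mul // ltn_predRL. Qed.

Lemma sweep_off0_gt0 : 0 < frob (off (A 0%N)).
Proof.
have sm := small npairs_gt0; rewrite real_normK ?num_real // in sm.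
have hoff := fl_jacobi_step_off u_gt0 u_lt1 w_ge6 (pq 0) (symA 0) (steps 0).
rewrite -/(G 0) -/(H 0) -/g4 in hoff.
have := sqr_ge0 (frob (off (A 1%N))).
have phi0 : 0 <= varphi (A 0%N) (p 0%N) (q 0%N) by exact: sqrtr_ge0.
have off0 := frob_ge0 (off (A 0%N)).
have h1 : 0 <= varphi (A 0%N) (p 0%N) (q 0%N) ^+ 2 * g4 ^+ 2.
  by rewrite mulr_ge0 ?sqr_ge0.
have h2 : 0 <= frob (off (A 0%N)) * varphi (A 0%N) (p 0%N) (q 0%N) * g4.
  by rewrite !mulr_ge0.
have h3 := sqr_ge0 (A 0%N (p 0%N) (q 0%N)).
move=> h4; rewrite lt_def off0 andbT; apply/negP => /eqP off00.
by rewrite off00 expr0n /= in hoff; lra.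
Qed.

(** With [a_k] the pivot of step [k]: [`|s k| <= 2 `|a_k| / md], and Cauchy-Schwarz
for the sum of the [`|a_k|]. *)
Lemma sweep_angles_le (mH md : R) : 0 < md ->
  (forall k : 'I_N, H k <= mH) -> (forall k : 'I_N, md <= spectral_gap (A k)) ->
  \sum_(k < N) `|s k| * H k
    <= mH / md * (Num.sqrt (2 * N%:R) * Num.sqrt (2 * \sum_(k < N) A k (p k) (q k) ^+ 2)).
Proof.
move=> md0 HmH mdd.
have term (k : 'I_N) : `|s k| * H k <= mH / md * (2 * `|A k (p k) (q k)|).
  have kN := ltnW (ltn_ord k).
  have gap0 := sweep_spectral_gap_gt0 kN.
  have sk : `|s k| <= 2 * `|A k (p k) (q k)| / md.
    apply: le_trans (jacobi_s_le n_ge2 (symA k) (pq k) gap0 (ltW (sweep_off_lt_gap kN))) _.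
    by rewrite ler_wpM2l ?mulr_ge0 // lef_pV2 ?posrE.
  have -> : mH / md * (2 * `|A k (p k) (q k)|) = 2 * `|A k (p k) (q k)| / md * mH by ring.
  by rewrite ler_pM ?frob_ge0.
apply: le_trans (ler_sum _ (fun k _ => term k)) _.
have N0 := npairs_gt0.
rewrite -mulr_sumr ler_wpM2l ?divr_ge0 ?(ltW md0) //.
  exact: le_trans (frob_ge0 _) (HmH (Ordinal N0)).
rewrite -mulr_sumr -sqrtrM ?mulr_ge0 ?ler0n //.
have sum0 : 0 <= \sum_(k < N) A k (p k) (q k) ^+ 2.
  by apply: sumr_ge0 => k _; exact: sqr_ge0.
have -> : 2 * N%:R * (2 * \sum_(k < N) A k (p k) (q k) ^+ 2)
    = 2 ^+ 2 * (N%:R * \sum_(k < N) A k (p k) (q k) ^+ 2) by ring.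
rewrite sqrtrM ?sqr_ge0 // sqrtr_sqr ger0_norm // ler_wpM2l //.
apply: le_trans (sum_le_sqrt _) _; rewrite ler_wsqrtr // ler_wpM2l ?ler0n //.
by apply: ler_sum => k _; rewrite real_normK ?num_real.
Qed.

End JacobiSweep.

Theorem theorem3p14 :
  exists w0 : nat, (0 < w0)%N /\
  forall w : nat, (w0 <= w)%N ->
  forall (R : realType) (u : R), 0 < u -> u < 1 ->
  forall n : nat, (2 <= n)%N ->
  forall (A0 : 'M[R]_n) (A : nat -> 'M[R]_n) (p q : nat -> 'I_n),
    A0^T = A0 ->
    A 0%N = A0 ->
    general_cyclic_order p q ->
    (forall k : nat, fl_jacobi_step w u (A k) (p k) (q k) (A k.+1)) ->
    injective (fun i : 'I_n => lambda A0 i) ->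
    frob (off A0) < spectral_gap A0 / 4 ->
    (forall k : nat, (k < npairs n)%N ->
       let phi := varphi (A k) (p k) (q k) in
       let G := frob (Gpart (A k) (p k) (q k)) in
       let H := frob (Hpart (A k) (p k) (q k)) in
       let g4 := gammat w u 4 in
       1 / 8 * phi ^+ 2 * g4 ^+ 2 + 1 / 2 * frob (off (A k)) * phi * g4
         + H ^+ 2 * g4 + G ^+ 2 * g4 ^+ 2
       < `|A k (p k) (q k)| ^+ 2) ->
    (exists2 dlow : R, 0 < dlow &
       spectral_gap A0 >= dlow +
         \sum_(k < npairs n) 2 * varphi (A k) (p k) (q k) * gammat w u 4) ->
    frob (off (A (npairs n))) <=
      alpha1 w u A p q * frob (off A0) ^+ 2 + beta1 w u A p q * gammat w u 4.
Proof.
exists 6%N; split=> // w w6 R u u0 u1 n n2 A0 A p q symA0 A0E.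
subst A0 => cyc steps _ offA0 small _.
have off0 := sweep_off0_gt0 u0 u1 w6 n2 symA0 cyc steps small.
pose H k := frob (Hpart (A k) (p k) (q k)); pose G k := frob (Gpart (A k) (p k) (q k)).
rewrite /beta1 /alpha1 -/(H 0%N).
set mH := \big[Num.max/H 0%N]_(k < npairs n) _.
set md := \big[Num.min/_]_(k < npairs n) _.
set Gam := (1 + gammat w u 2) ^+ _.
set g4 := gammat w u 4.
have HmH (k : 'I_(npairs n)) : H k <= mH by exact: le_bigmax.
have mdd (k : 'I_(npairs n)) : md <= spectral_gap (A k) by exact: bigmin_le.
have gap0 := sweep_spectral_gap_gt0 u0 u1 w6 n2 symA0 cyc steps small offA0.
have md0 : 0 < md.
  by apply: lt_bigmin => [|k _]; apply: gap0 => //; exact: ltnW.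
have Gam0 : 0 <= Gam by rewrite exprn_ge0 // addr_ge0 // gammat_ge0.
have g40 : 0 <= g4 by exact: gammat_ge0.
have sG : 0 <= \sum_(k < npairs n) G k ^+ 2 by apply: sumr_ge0 => k _; exact: sqr_ge0.
have sH : 0 <= \sum_(k < npairs n) H k ^+ 2 by apply: sumr_ge0 => k _; exact: sqr_ge0.
set a0 := frob (off (A 0%N)) in off0 *.
pose Q := a0 ^+ 2 + (\sum_(k < npairs n) H k ^+ 2) * g4
  + (\sum_(k < npairs n) G k ^+ 2) * g4 ^+ 2.
have Qa0 : a0 ^+ 2 <= Q.
  by rewrite /Q -addrA lerDl addr_ge0 ?mulr_ge0 ?sqr_ge0.
have Q0 : 0 <= Q := le_trans (sqr_ge0 _) Qa0.
(* This trades the square root for the denominator of alpha1. *)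
have sqrtQ : Num.sqrt Q <= Q / a0.
  rewrite ler_pdivlMr // -[X in _ <= X](sqr_sqrtr Q0) expr2 ler_wpM2l ?sqrtr_ge0 //.
  by have := ler_wsqrtr Qa0; rewrite sqrtr_sqr ger0_norm // ltW.
have pivots := sum_sqr_pivots u0 u1 w6 symA0 cyc steps (npairs n).
rewrite -!mulr_suml -/a0 -/g4 -/Q in pivots.
have angles := sweep_angles_le u0 u1 w6 n2 symA0 cyc steps small offA0 md0 HmH mdd.
have res := frob_residual u0 u1 w6 symA0 cyc steps.
have mH0 : 0 <= mH := le_trans (frob_ge0 _) (HmH (Ordinal (npairs_gt0 n2))).
apply: le_trans (sweep_off_le u0 u1 w6 symA0 cyc steps) _.
have -> : Gam * Num.sqrt (2 * (npairs n)%:R) * (mH / (md * a0)) * a0 ^+ 2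
   + (Gam * Num.sqrt (2 * (npairs n)%:R) * (mH / (md * a0))
       * (\sum_(k < npairs n) H k ^+ 2 + (\sum_(k < npairs n) G k ^+ 2) * g4)
      + Gam * Num.sqrt (2 * \sum_(k < npairs n) G k ^+ 2)) * g4
   = Gam * (Num.sqrt (2 * \sum_(k < npairs n) G k ^+ 2) * g4
      + mH / md * (Num.sqrt (2 * (npairs n)%:R) * (Q / a0))).
  by rewrite invfM /Q; ring.
rewrite ler_wpM2l // lerD //.
  apply: le_trans res _; rewrite ler_wpM2r // ler_wsqrtr //.
  by rewrite ler_peMl // ler1n.
apply: le_trans angles _; rewrite ler_wpM2l ?divr_ge0 ?(ltW md0) //.
rewrite ler_wpM2l ?sqrtr_ge0 // (le_trans _ sqrtQ) // ler_wsqrtr //.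
Qed.
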